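(* For every convex body $K\subset\mathbb{R}^n$ and every $\mu\in\Lambda$, $$\mu_\lambda(K)\le \mu\big(n\,\mathrm{Vol}_n(K)\,\Pi^\circ K\big).$$ Furthermore, this inequality is sharp over $\Lambda$, in the sense that equality is obtained asymptotically for the standard Gaussian measure $\gamma_n$.
   Context: A convex body in $\mathbb{R}^n$ is a compact convex set with nonempty interior; $h_K(x)=\sup_{y\in K}\langle x,y\rangle$ is its support function. $\Lambda$ is the set of all locally finite, regular Borel measures $\mu$ on $\mathbb{R}^n$ having a density $\phi:\mathbb{R}^n\to[0,\infty)$, $\phi\in L^1_{\mathrm{loc}}(\mathbb{R}^n)$, with respect to Lebesgue measure $\lambda$. The translated average of $K$ with respect to $\mu$ is $$\mu_\lambda(K)=\frac{1}{\mathrm{Vol}_n(K)}\int_K\mu(y-K)\,dy .$$ The projection body $\Pi K$ is the convex body with $h_{\Pi K}(\theta)=\mathrm{Vol}_{n-1}(P_{\theta^\perp}K)$ for $\theta\in\mathbb{S}^{n-1}$, where $P_{\theta^\perp}$ is the orthogonal projection onto $\theta^\perp$, and $\Pi^\circ K=(\Pi K)^\circ=\{x:h_{\Pi K}(x)\le1\}$. The standard Gaussian measure is $d\gamma_n(x)=(2\pi)^{-n/2}e^{-|x|^2/2}dx$. *)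

(* Defs.v *)
From HB Require Import structures.
From mathcomp Require Import all_boot all_order all_algebra.
From mathcomp Require Import all_classical all_reals all_analysis.
From mathcomp Require Import measurable_realfun.

Set Implicit Arguments.
Unset Strict Implicit.
Unset Printing Implicit Defensive.

Import Order.TTheory GRing.Theory Num.Theory.
Import numFieldNormedType.Exports.

Local Open Scope classical_set_scope.
Local Open Scope ring_scope.

(* R^n is 'rV[R]_n. The library norm on it is the sup norm, used here only for
   its topology, which is the usual one. *)

Section borel.
Variables (R : realType) (n : nat).

Definition borel_sets : set (set 'rV[R]_n) := <<s open >>.

Let borel_set0 : borel_sets set0.
Proof. exact: sigma_algebra0. Qed.

Let borel_setC A : borel_sets A -> borel_sets (~` A).
Proof. exact: sigma_algebraC. Qed.

Let borel_bigcup (F : (set 'rV[R]_n)^nat) :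
  (forall i, borel_sets (F i)) -> borel_sets (\bigcup_i F i).
Proof. exact: sigma_algebra_bigcup. Qed.

HB.instance Definition _ := @isMeasurable.Build
  (sigma_display borel_sets) 'rV[R]_n borel_sets
  borel_set0 borel_setC borel_bigcup.

Lemma open_measurable_rV (U : set 'rV[R]_n) : open U -> measurable U.
Proof. by move=> oU; apply: sub_sigma_algebra. Qed.

End borel.

(* The library's product of two sigma-finite measures, with the sigma-finite
   structure that canonical inference does not find on it. *)
Section sigma_finite_product.
Local Open Scope ereal_scope.
Context d1 d2 (T1 : measurableType d1) (T2 : measurableType d2) (R : realType).
Variable m1 : {sigma_finite_measure set T1 -> \bar R}.
Variable m2 : {sigma_finite_measure set T2 -> \bar R}.

Definition sf_prod : set (T1 * T2) -> \bar R := m1 \x m2.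

Let sf_prod_sigma_finite : sigma_finite setT sf_prod.
Proof.
have /sigma_finiteP[F [TF ndF Foo]] := sigma_finiteT m1.
have /sigma_finiteP[G [TG ndG Goo]] := sigma_finiteT m2.
exists (fun n => F n `*` G n).
  rewrite -setXTT TF TG predeqE => -[x y]; split.
    move=> [/= [n _ Fnx] [k _ Gky]]; exists (maxn n k) => //; split.
    - by move: x Fnx; exact/subsetPset/ndF/leq_maxl.
    - by move: y Gky; exact/subsetPset/ndG/leq_maxr.
  by move=> [n _ []/= ? ?]; split; exists n.
move=> k; have [? ?] := Foo k; have [? ?] := Goo k.
split; first exact: measurableX.
by rewrite /sf_prod product_measure1E// lte_mul_pinfty// ge0_fin_numE.
Qed.

HB.instance Definition _ := Measure.copy sf_prod (m1 \x m2).
HB.instance Definition _ :=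
  Measure_isSigmaFinite.Build _ _ _ sf_prod sf_prod_sigma_finite.

End sigma_finite_product.

(* The measure space (R, Lebesgue)^n, as R * (R * (... * unit)). *)
Record sfspace (R : realType) := SFSpace {
  sf_display : measure_display;
  sf_carrier : measurableType sf_display;
  sf_measure : {sigma_finite_measure set sf_carrier -> \bar R} }.

Fixpoint iprod (R : realType) (n : nat) : sfspace R :=
  if n is m.+1 then
    @SFSpace R _ (measurableTypeR R * sf_carrier (iprod R m))%type
      (sf_prod (@lebesgue_measure R) (sf_measure (iprod R m)))
  else @SFSpace R _ unit (@dirac _ unit tt R).

Fixpoint iprod_coord (R : realType) (n : nat) :
    sf_carrier (iprod R n) -> nat -> R :=
  if n is m.+1 return sf_carrier (iprod R n) -> nat -> R then
    fun t i => if i is j.+1 then iprod_coord t.2 j else t.1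
  else fun _ _ => 0.

Definition iprod_row (R : realType) (n : nat) (t : sf_carrier (iprod R n)) :
  'rV[R]_n := \row_(i < n) iprod_coord t i.

Section iprod_row_measurable.
Variable R : realType.

Lemma measurable_iprod_coord (n i : nat) :
  measurable_fun setT (fun t : sf_carrier (iprod R n) => iprod_coord t i : R).
Proof.
elim: n i => [|n IHn] i /=; first exact: measurable_cst.
case: i => [|i]; first exact: measurable_fst.
exact: (measurableT_comp (IHn i) measurable_snd).
Qed.

(* A set open in R^n is a countable union of balls with rational centre and
   radius 1/(k+1); the balls of the sup norm are boxes. *)
Lemma open_rV_bigcup (n : nat) (U : set 'rV[R]_n) : open U ->
  U = \bigcup_(p in [set p : 'rV[rat]_n * nat |
        (ball (map_mx ratr p.1 : 'rV[R]_n) (p.2.+1%:R^-1)) `<=` U])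
      ball (map_mx ratr p.1 : 'rV[R]_n) (p.2.+1%:R^-1).
Proof.
move=> oU; apply/seteqP; split => [x Ux|x [p]]; last by exact.
have /nbhs_ballP[e /= e0 eU] := open_nbhs_nbhs (conj oU Ux).
have e20 : 0 < e / 2 by rewrite divr_gt0.
have [k ke] : exists k : nat, k.+1%:R^-1 < e / 2.
  by have [k _ /(_ _ (leqnn k))] := near_infty_natSinv_lt (PosNum e20); exists k.
have hq i : exists q : rat, `|x ord0 i - ratr q| < k.+1%:R^-1.
  have k0 : (0 : R) < k.+1%:R^-1 by rewrite invr_gt0.
  have /rat_in_itvoo[q] : x ord0 i - k.+1%:R^-1 < x ord0 i + k.+1%:R^-1.
    by rewrite ltrD2l gtrN.
  rewrite in_itv/= => /andP[q1 q2]; exists q.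
  by rewrite distrC ltr_distl q1 q2.
have [q hq'] := choice hq.
have bx : ball (map_mx ratr (\row_i q i) : 'rV[R]_n) k.+1%:R^-1 x.
  split => [|i j]; first by rewrite invr_gt0.
  rewrite !mxE (ord1 i) /ball/=; rewrite distrC; exact: hq'.
exists (\row_i q i, k) => //= y yb; apply: eU.
apply: (le_ball (_ : k.+1%:R^-1 + k.+1%:R^-1 <= e)).
  by rewrite [leRHS]splitr lerD// ltW.
by apply: ball_triangle yb; exact: ball_sym.
Qed.

Lemma measurable_iprod_row (n : nat) :
  measurable_fun setT (@iprod_row R n).
Proof.
apply: (measurability (open : set (set 'rV[R]_n))) => //.
move=> _ [U oU <-]; rewrite setTI (open_rV_bigcup oU) bigcup_mkcond.
rewrite preimage_bigcup; apply: countable_bigcupT_measurable => [|p].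
  exact: countableP.
case: ifPn => _; last by rewrite preimage_set0.
set r := p.2.+1%:R^-1.
rewrite (_ : _ @^-1` _ = \bigcap_(i in [set: 'I_n])
  ((fun t : sf_carrier (iprod R n) => iprod_coord t i) @^-1`
    ball (ratr (p.1 ord0 i) : R) r)).
  apply: fin_bigcap_measurable => [|i _]; first exact: finite_finset.
  rewrite -[X in measurable X]setTI; apply: measurable_iprod_coord => //.
  exact: measurable_ball.
apply/seteqP; split => t /=.
  by move=> [_ h] i _; have := h ord0 i; rewrite !mxE.
by move=> h; split => [|i j]; rewrite ?invr_gt0// (ord1 i) !mxE; exact: h.
Qed.

End iprod_row_measurable.

Section volume.
Variables (R : realType) (n : nat).

Definition lebesgue_rV : set 'rV[R]_n -> \bar R :=
  pushforward (sf_measure (iprod R n)) (@iprod_row R n).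

Let lebesgue_rV0 : lebesgue_rV set0 = 0%E.
Proof. by rewrite /lebesgue_rV /pushforward preimage_set0 measure0. Qed.

Let lebesgue_rV_ge0 A : (0 <= lebesgue_rV A)%E.
Proof. by rewrite /lebesgue_rV /pushforward measure_ge0. Qed.

Let lebesgue_rV_sigma_additive : semi_sigma_additive lebesgue_rV.
Proof.
have mf A : measurable A -> measurable (@iprod_row R n @^-1` A).
  by move=> mA; rewrite -[X in measurable X]setTI; exact: measurable_iprod_row.
move=> F mF tF mUF; rewrite /lebesgue_rV /pushforward preimage_bigcup.
apply: measure_semi_sigma_additive.
- by move=> i; exact: mf.
- apply/trivIsetP => /= i j _ _ ij; rewrite -preimage_setI.
  by move/trivIsetP : tF => /(_ _ _ _ _ ij) ->//; rewrite preimage_set0.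
- by rewrite -preimage_bigcup; exact: mf.
Qed.

HB.instance Definition _ := isMeasure.Build _ _ _ lebesgue_rV
  lebesgue_rV0 lebesgue_rV_ge0 lebesgue_rV_sigma_additive.

Definition vol (A : set 'rV[R]_n) : R := fine (lebesgue_rV A).

End volume.

Section convex_bodies.
Variables (R : realType) (n : nat).
Implicit Types (K P A : set 'rV[R]_n) (x y u : 'rV[R]_n).

Definition dot x y : R := \sum_(i < n) x ord0 i * y ord0 i.

Definition dilate (c : R) A : set 'rV[R]_n := [set c *: x | x in A].

Definition convex_body K := [/\ compact K, convex_set K & K^° !=set0].

Definition support_function K x : R := sup [set dot x y | y in K].

(* orthogonal projection onto the hyperplane u^perp, for a unit vector u *)
Definition proj_perp u x : 'rV[R]_n := x - dot x u *: u.

(* A matrix whose rows form an orthonormal basis of u^perp; such a matrix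
   exists when u is a unit vector. *)
Definition perp_frame u : 'M[R]_(n.-1, n) :=
  xget 0 [set B : 'M[R]_(n.-1, n) | B *m B^T = 1%:M /\ B *m u^T = 0].

(* Vol_{n-1} of a subset A of u^perp: the Lebesgue measure of A read in R^(n-1)
   through the linear isometry w |-> w *m perp_frame u onto u^perp. It does not
   depend on the choice of the orthonormal basis. *)
Definition vol_perp u A : R := vol [set w : 'rV[R]_n.-1 | A (w *m perp_frame u)].

Definition is_projection_body K P := convex_body P /\
  forall u, dot u u = 1 ->
    support_function P u = vol_perp u [set proj_perp u x | x in K].

(* "The" convex body Pi K: a convex body is determined by the values of its
   support function on the sphere, and is_projection_body K is satisfied by one
   whenever K is a convex body. *)
Definition projection_body K : set 'rV[R]_n :=
  xget set0 (is_projection_body K).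

Definition polar_projection_body K : set 'rV[R]_n :=
  [set x | support_function (projection_body K) x <= 1].

End convex_bodies.

Section measures.
Variables (R : realType) (n : nat).
Local Notation E := 'rV[R]_n.

Definition locally_finite_measure (mu : {measure set E -> \bar R}) :=
  forall x : E, exists2 U, open_nbhs x U & (mu U < +oo)%E.

Definition regular_measure (mu : {measure set E -> \bar R}) :=
  forall A : set E, measurable A ->
    mu A = ereal_inf [set mu U | U in [set U | open U /\ A `<=` U]] /\
    mu A = ereal_sup [set mu C | C in [set C | compact C /\ C `<=` A]].

Definition locally_L1 (f : E -> R) := measurable_fun setT f /\
  forall C : set E, compact C -> (@lebesgue_rV R n).-integrable C (EFin \o f).

Definition has_density (mu : {measure set E -> \bar R}) (f : E -> R) :=
  forall A : set E, measurable A ->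
    mu A = (\int[@lebesgue_rV R n]_(x in A) (f x)%:E)%E.

Definition Lambda (mu : {measure set E -> \bar R}) :=
  [/\ locally_finite_measure mu, regular_measure mu &
      exists f : E -> R, [/\ forall x, 0 <= f x, locally_L1 f
                           & has_density mu f]].

Definition translated_average (mu : {measure set E -> \bar R}) (K : set E) :
    \bar R :=
  ((vol K)^-1%:E *
   \int[@lebesgue_rV R n]_(y in K) mu [set (y - z)%R | z in K])%E.

Definition gauss_density (x : E) : R :=
  (2 * pi) `^ (- (n%:R / 2)) * expR (- (dot x x / 2)).

Lemma gauss_density_ge0 x : 0 <= gauss_density x.
Proof. by rewrite mulr_ge0 ?powR_ge0 ?expR_ge0. Qed.

Lemma measurable_coord_rV (i : 'I_n) :
  measurable_fun setT (fun x : E => x ord0 i : R).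
Proof.
apply: (measurability _ (RGenOpens.measurableE R)).
move=> _ [_ [a [b ->] <-]]; rewrite setTI; apply: open_measurable_rV.
have /continuousP := @coord_continuous R 1 n ord0 i.
by apply; exact: interval_open.
Qed.

Lemma measurable_gauss_density : measurable_fun setT gauss_density.
Proof.
apply: measurable_funM => //; apply: measurableT_comp => //.
apply: measurable_funN; apply: measurable_funM => //.
apply: measurable_sum => i.
by apply: measurable_funM; exact: measurable_coord_rV.
Qed.

Definition gaussian (A : set E) : \bar R :=
  (\int[@lebesgue_rV R n]_(x in A) (gauss_density x)%:E)%E.

Let gaussian0 : gaussian set0 = 0%E.
Proof. by rewrite /gaussian integral_set0. Qed.

Let gaussian_ge0 A : (0 <= gaussian A)%E.
Proof. by apply: integral_ge0 => x _; rewrite lee_fin gauss_density_ge0. Qed.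

Let gaussian_sigma_additive : semi_sigma_additive gaussian.
Proof.
move=> /= A mA tA mUA; rewrite /gaussian ge0_integral_bigcup//=.
- apply: is_cvg_ereal_nneg_natsum_cond => k _ _.
  by apply: integral_ge0 => x _; rewrite lee_fin gauss_density_ge0.
- by apply/measurable_EFinP/measurable_funTS; exact: measurable_gauss_density.
- by move=> x _; rewrite lee_fin gauss_density_ge0.
Qed.

HB.instance Definition _ := isMeasure.Build _ _ _ gaussian
  gaussian0 gaussian_ge0 gaussian_sigma_additive.

End measures.

(* Main.v *)
From HB Require Import structures.
Require Import Defs.
From mathcomp Require Import all_boot all_order all_algebra.
From mathcomp Require Import all_classical all_reals all_analysis.
From mathcomp Require Import measurable_realfun.
From mathcomp Require Import ring lra.

Set Implicit Arguments.
Unset Strict Implicit.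
Unset Printing Implicit Defensive.

Import Order.TTheory GRing.Theory Num.Theory.
Import numFieldNormedType.Exports.

Local Open Scope classical_set_scope.
Local Open Scope ring_scope.

(* Every y in K satisfies y - K `<=` K - K, so mu_lambda(K) <= mu(K - K), and it
   suffices that K - K `<=` n Vol(K) Pi^o K: if K contains a segment of length L
   in the unit direction u, then L Vol_(n-1)(P K) <= n Vol(K), P the projection
   along u. Indeed, by convexity, the chord of K in direction u over the point
   w0 + (1 - t) (p - w0), where w0 is the projection of the segment and p is in
   P K, has length at least t L; so Vol(K) is at least the volume of a cone of
   height L over P K. Fubini's theorem in a frame adapted to u needs the
   invariance of the Lebesgue measure under orthogonal maps, which comes from
   the uniqueness of Haar measure, normalized on the Euclidean ball.

   For the Gaussian measure both sides are at most 1. Let x0 be interior to K.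
   If y is in t (x0 + (1 - e) (K - x0)) then y - t K contains a cube of
   half-side proportional to t e, so that
   mu_lambda(t K) >= (1 - e)^n gamma(cube), which is close to 1 for large t.

   Only K - K `<=` n Vol(K) Pi^o K refers to the projection body, so no proof of
   its existence is needed: were there none, xget would return set0, whose polar
   is the whole space. *)

(** * Measurability in R^n *)

Section measurability.
Variable R : realType.

(** An open set is a countable union of rational cubes, and the preimage of a cube is a finite
    intersection of coordinate preimages. *)
Lemma measurable_fun_rV d (T : measurableType d) n (f : T -> 'rV[R]_n) :
  (forall i, measurable_fun setT (fun t => f t ord0 i : R)) ->
  measurable_fun setT f.
Proof.
move=> mf; apply: (measurability (open : set (set 'rV[R]_n))) => //.
move=> _ [U oU <-]; rewrite setTI (open_rV_bigcup oU) bigcup_mkcond.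
rewrite preimage_bigcup; apply: countable_bigcupT_measurable => [|p].
  exact: countableP.
case: ifPn => _; last by rewrite preimage_set0.
set r := p.2.+1%:R^-1.
rewrite (_ : _ @^-1` _ = \bigcap_(i in [set: 'I_n])
  ((fun t => f t ord0 i) @^-1` ball (ratr (p.1 ord0 i) : R) r)).
  apply: fin_bigcap_measurable => [|i _]; first exact: finite_finset.
  by rewrite -[X in measurable X]setTI; apply: mf => //; exact: measurable_ball.
apply/seteqP; split => t /=.
  by move=> [_ h] i _; have := h ord0 i; rewrite !mxE.
by move=> h; split => [|i j]; rewrite ?invr_gt0// (ord1 i) !mxE; exact: h.
Qed.

Lemma closed_measurable_rV n (A : set 'rV[R]_n) : closed A -> measurable A.
Proof.
move=> cA; rewrite -(setCK A); apply: measurableC; apply: open_measurable_rV.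
exact: closed_openC.
Qed.

Lemma compact_measurable_rV n (A : set 'rV[R]_n) : compact A -> measurable A.
Proof.
by move=> cA; apply: closed_measurable_rV; apply: compact_closed.
Qed.

Lemma measurable_preimage d d' (T : measurableType d) (T' : measurableType d')
  (f : T -> T') (A : set T') :
  measurable_fun setT f -> measurable A -> measurable (f @^-1` A).
Proof. by move=> mf mA; rewrite -[X in measurable X]setTI; exact: mf. Qed.

Lemma measurable_mulmx d (T : measurableType d) n m (f : T -> 'rV[R]_n)
  (M : 'M[R]_(n, m)) :
  measurable_fun setT f -> measurable_fun setT (fun t => f t *m M).
Proof.
move=> mf; apply: measurable_fun_rV => i.
under eq_fun do rewrite mxE.
apply: measurable_sum => k; apply: measurable_funM => //.
exact: (measurableT_comp (measurable_coord_rV k) mf).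
Qed.

Lemma measurable_add_rV d (T : measurableType d) n (f g : T -> 'rV[R]_n) :
  measurable_fun setT f -> measurable_fun setT g ->
  measurable_fun setT (fun t => f t + g t).
Proof.
move=> mf mg; apply: measurable_fun_rV => i.
under eq_fun do rewrite mxE.
apply: measurable_funD.
  exact: (measurableT_comp (measurable_coord_rV i) mf).
exact: (measurableT_comp (measurable_coord_rV i) mg).
Qed.

Lemma measurable_scale_rV d (T : measurableType d) n (c : T -> R)
  (f : T -> 'rV[R]_n) :
  measurable_fun setT c -> measurable_fun setT f ->
  measurable_fun setT (fun t => c t *: f t).
Proof.
move=> mc mf; apply: measurable_fun_rV => i.
under eq_fun do rewrite mxE.
apply: measurable_funM => //.
exact: (measurableT_comp (measurable_coord_rV i) mf).
Qed.

Lemma measurable_opp_rV d (T : measurableType d) n (f : T -> 'rV[R]_n) :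
  measurable_fun setT f -> measurable_fun setT (fun t => - f t).
Proof.
move=> mf; under eq_fun do rewrite -scaleN1r.
by apply: measurable_scale_rV.
Qed.

(** Identifies R x R^n with R^(n+1), first coordinate in front, in step with the recursion of
    [iprod]; this is what inductions on the dimension run on. *)
Definition cons_rV n (s : R) (w : 'rV[R]_n) : 'rV[R]_n.+1 :=
  \row_i (if unlift ord0 i is Some j then w ord0 j else s).

Lemma cons_rV0 n (s : R) (w : 'rV[R]_n) : cons_rV s w ord0 ord0 = s.
Proof. by rewrite mxE unlift_none. Qed.

Lemma cons_rVS n (s : R) (w : 'rV[R]_n) j :
  cons_rV s w ord0 (lift ord0 j) = w ord0 j.
Proof. by rewrite mxE liftK. Qed.

Lemma cons_rVD n (s t : R) (v w : 'rV[R]_n) :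
  cons_rV s v + cons_rV t w = cons_rV (s + t) (v + w).
Proof. by apply/rowP => i; rewrite !mxE; case: unliftP => // j;
  rewrite mxE. Qed.

Lemma cons_rVE n (v : 'rV[R]_n.+1) :
  v = cons_rV (v ord0 ord0) (\row_j v ord0 (lift ord0 j)).
Proof. by apply/rowP => i; rewrite mxE; case: unliftP => [j|] ->;
  rewrite ?mxE. Qed.

Lemma dot_cons_rV n (s t : R) (v w : 'rV[R]_n) :
  dot (cons_rV s v) (cons_rV t w) = s * t + dot v w.
Proof.
rewrite /dot big_ord_recl !cons_rV0; congr (_ + _).
by apply: eq_bigr => j _; rewrite !cons_rVS.
Qed.

Lemma mul_cons_rV n m (s : R) (w : 'rV[R]_n) (M : 'M[R]_(n.+1, m)) :
  cons_rV s w *m M = s *: row ord0 M + w *m row' ord0 M.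
Proof.
apply/rowP => i; rewrite !mxE big_ord_recl cons_rV0; congr (_ + _).
by apply: eq_bigr => j _; rewrite cons_rVS !mxE.
Qed.

Lemma iprod_row_cons n (t : sf_carrier (iprod R n.+1)) :
  iprod_row t = cons_rV t.1 (iprod_row t.2).
Proof.
apply/rowP => i; rewrite !mxE.
by case: unliftP => [j|] ->; rewrite ?mxE.
Qed.

Lemma measurable_cons_rV n :
  measurable_fun setT
    (fun p : measurableTypeR R * 'rV[R]_n => cons_rV p.1 p.2).
Proof.
apply: measurable_fun_rV => i.
under eq_fun do rewrite mxE.
case: unliftP => [j|] _; last exact: measurable_fst.
exact: (measurableT_comp (measurable_coord_rV j) measurable_snd).
Qed.

End measurability.

(** * Tonelli's theorem for sets *)

Section sections.
Local Open Scope ereal_scope.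
Context d1 d2 (T1 : measurableType d1) (T2 : measurableType d2) (R : realType).
Variable m1 : {sigma_finite_measure set T1 -> \bar R}.
Variable m2 : {sigma_finite_measure set T2 -> \bar R}.

(** Both sides are the product measure of [A]: Tonelli's theorem for its indicator. *)
Lemma integral_sections (A : set (T1 * T2)) : measurable A ->
  \int[m1]_x m2 [set y | A (x, y)] = \int[m2]_y m1 [set x | A (x, y)].
Proof.
move=> mA; have := indic_fubini_tonelli m1 m2 mA.
rewrite indic_fubini_tonelli_FE// indic_fubini_tonelli_GE//.
under eq_integral do rewrite /= xsectionE.
by under [in X in _ = X -> _]eq_integral do rewrite /= ysectionE.
Qed.

Lemma measurable_fun_section (A : set (T1 * T2)) : measurable A ->
  measurable_fun setT (fun y => m1 [set x | A (x, y)]).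
Proof.
move=> /(measurable_fun_ysection m1); congr (measurable_fun _ _).
by apply/funext => y /=; rewrite ysectionE.
Qed.

Lemma integral_section_cst (F : set T1) (G : T1 -> set T2) c : measurable F ->
  (forall x, F x -> m2 (G x) = c) ->
  \int[m1]_x m2 [set y | F x /\ G x y] = c * m1 F.
Proof.
move=> mF Gc; rewrite -integral_cst// [RHS]integral_mkcond.
apply: eq_integral => x _; rewrite patchE; case: ifPn => [/[!inE] Fx|].
  by rewrite -(Gc _ Fx); congr (m2 _); apply/seteqP; split => y //= [].
rewrite notin_setE => Fx; apply: etrans (measure0 m2); congr (m2 _).
by rewrite -subset0 => y [].
Qed.

End sections.

(** * Lebesgue measure on R^n *)

Section lebesgue_rV_theory.
Variable R : realType.
Local Open Scope ereal_scope.
Local Notation mu1 := (@lebesgue_measure R).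
Local Notation leb n := (@lebesgue_rV R n).

Lemma lebesgue_rVS n (A : set 'rV[R]_n.+1) :
  leb n.+1 A = \int[mu1]_s leb n [set w | A (cons_rV s w)].
Proof.
rewrite /lebesgue_rV /pushforward /= /sf_prod /product_measure1.
apply: eq_integral => s _ /=; congr (sf_measure _ _).
by rewrite xsectionE; apply/seteqP; split => t /=; rewrite iprod_row_cons.
Qed.

Lemma measurable_cons_section n (A : set 'rV[R]_n.+1) s :
  measurable A -> measurable [set w : 'rV[R]_n | A (cons_rV s w)].
Proof.
move=> mA; apply: (measurable_preimage (f := fun w => cons_rV s w)) => //.
exact: (measurable_fun_pair2 s (@measurable_cons_rV R n)).
Qed.

(** The image of Lebesgue measure under a translation agrees with it on half-open intervals, which
    determine the measure. *)
Lemma lebesgue_measure_translate (a : R) (A : set R) : measurable A ->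
  mu1 [set x | A (x + a)%R] = mu1 A.
Proof.
have ma : measurable_fun setT (fun x : measurableTypeR R => x + a : R)%R.
  exact: measurable_funD.
move=> mA; apply/esym.
rewrite (@lebesgue_measure_unique _ (pushforward mu1
  ((fun x => x + a)%R : measurableTypeR R -> measurableTypeR R)))//.
move=> _ [[b c] _ <-]; rewrite /pushforward.
transitivity (mu1 `](b - a)%R, (c - a)%R]%classic); last first.
  congr (mu1 _).
  by apply/seteqP; split => x /=; rewrite !in_itv/= ltrBlDr lerBrDr.
rewrite !lebesgue_measure_itv/= !lte_fin ltrD2r.
by case: ifP => // _; rewrite -!EFinD opprB addrA subrK.
Qed.

Lemma ge0_integral_translate (a : R) (f : R -> \bar R) :
  measurable_fun setT f -> (forall x, 0 <= f x) ->
  \int[mu1]_x f (x + a)%R = \int[mu1]_x f x.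
Proof.
have ma : measurable_fun setT
    ((fun x => x + a)%R : measurableTypeR R -> measurableTypeR R).
  exact: measurable_funD.
move=> mf f0; transitivity (\int[pushforward mu1
    ((fun x => x + a)%R : measurableTypeR R -> measurableTypeR R)]_x f x).
  by rewrite ge0_integral_pushforward// => x _; exact: f0.
apply: eq_measure_integral => A mA _; exact: lebesgue_measure_translate.
Qed.

Lemma measurable_lebesgue_rV_section n (A : set 'rV[R]_n.+1) : measurable A ->
  measurable_fun setT
    (fun s : measurableTypeR R => leb n [set w | A (cons_rV s w)]).
Proof.
move=> mA; have := measurable_fun_xsection (sf_measure (iprod R n))
  (measurable_preimage (@measurable_iprod_row R n.+1) mA).
congr (measurable_fun _ _); apply/funext => s.
rewrite /lebesgue_rV /pushforward /=; congr (sf_measure _ _).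
by rewrite xsectionE; apply/seteqP; split => t /=; rewrite iprod_row_cons.
Qed.

Lemma measurable_translate n (v : 'rV[R]_n) (A : set 'rV[R]_n) :
  measurable A -> measurable [set x | A (x + v)%R].
Proof.
move=> mA; apply: (measurable_preimage
  (f := fun x : 'rV[R]_n => (x + v : 'rV[R]_n)%R)) => //.
exact: measurable_add_rV.
Qed.

(** By induction on the dimension: slicing along the first coordinate, the slices are translated by
    the induction hypothesis and the slicing variable by the one-dimensional case. *)
Lemma lebesgue_rV_translate n (v : 'rV[R]_n) (A : set 'rV[R]_n) :
  measurable A ->
  leb n [set x | A (x + v)%R] = leb n A.
Proof.
elim: n => [|n IHn] in v A *.
  move=> mA; congr (leb 0 _); apply/seteqP; split => x /=;
    by rewrite (_ : (x + v)%R = x)// [RHS]thinmx0 [LHS]thinmx0.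
move=> mA; rewrite !lebesgue_rVS.
have ge0 s : 0 <= leb n [set w | A (cons_rV s w)].
  exact: measure_ge0.
rewrite -(ge0_integral_translate (v ord0 ord0)
  (measurable_lebesgue_rV_section mA) ge0).
apply: eq_integral => s _.
rewrite -(IHn (\row_j v ord0 (lift ord0 j)) [set w | A (cons_rV (s + _) w)]).
  congr (leb n _); apply/funext => w /=; congr (A _).
  by rewrite {1}[v]cons_rVE cons_rVD.
exact: measurable_cons_section.
Qed.

(** Closed cubes centred at 0. Their explicit measure makes them the test sets for finiteness,
    positivity, scaling and exhaustion. *)
Definition box n (r : R) : set 'rV[R]_n := [set x | forall i,
  (`|x ord0 i| <= r)%R].
Arguments box : clear implicits.

Lemma measurable_box n (r : R) : measurable (box n r).
Proof.
rewrite (_ : box n r = \bigcap_(i in [set: 'I_n])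
   ((fun x : 'rV[R]_n => x ord0 i) @^-1` `[- r, r]%classic)%R).
  apply: fin_bigcap_measurable => [|i _]; first exact: finite_finset.
  by apply: measurable_preimage => //; exact: measurable_coord_rV.
apply/seteqP; split => x /= h i.
  by move=> _ /=; rewrite in_itv/= -ler_norml.
by have := h i I; rewrite /= in_itv/= -ler_norml.
Qed.

Lemma lebesgue_rV_box n (r : R) :
  (0 <= r)%R -> leb n (box n r) = ((r *+ 2) ^+ n)%:E.
Proof.
move=> r0; elim: n => [|n IHn].
  rewrite /lebesgue_rV /pushforward /= diracE mem_set ?expr0// => -[] //.
rewrite lebesgue_rVS.
transitivity (\int[mu1]_s ((cst (leb n (box n r))) \_ `[(- r)%R, r]%classic) s).
  apply: eq_integral => s _; rewrite patchE; case: ifPn => /=.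
    rewrite inE/= in_itv/= -ler_norml => sr; congr (leb n _).
    apply/seteqP; split => w /= h i; first by rewrite -(cons_rVS s).
    by case: (unliftP ord0 i) => [j|] ->; rewrite ?cons_rVS ?cons_rV0.
  rewrite notin_setE/= in_itv/= -ler_norml => sr.
  transitivity (leb n set0); last exact: measure0.
  congr (leb n _); rewrite -subset0 => w /= /(_ ord0).
  by rewrite cons_rV0.
rewrite -integral_mkcond integral_cst// IHn exprSr EFinM; congr (_ * _).
transitivity (mu1 `[(- r)%R, r]%classic) => //.
rewrite lebesgue_measure_itv/= lte_fin; case: ifPn => [_|].
  by rewrite -EFinD opprK -mulr2n.
(* What remains is the degenerate interval, reduced to a point when r = 0. *)
rewrite -leNgt => rN; suff -> : r = 0%R by rewrite mul0rn.
by apply/le_anti; rewrite r0 andbT -(@pmulrn_lle0 _ _ 2)// mulr2n -lerBrDr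
  sub0r.
Qed.

Let lebesgue_rV_sigma_finite n : sigma_finite setT (leb n).
Proof.
exists (fun k => box n k%:R).
  apply/esym; rewrite -subTset => x _ /=.
  exists (Num.bound `|x|%R) => //= i.
  have := archi_boundP (normr_ge0 x) => /ltW; apply: le_trans.
  rewrite [leRHS]mx_normrE.
  exact: (le_bigmax _ (fun ij => `|x ij.1 ij.2|%R) (ord0, i)).
move=> k; split; first exact: measurable_box.
by rewrite lebesgue_rV_box// ltry.
Qed.

HB.instance Definition _ n := Measure_isSigmaFinite.Build _ _ _ (leb n)
  (@lebesgue_rV_sigma_finite n).

End lebesgue_rV_theory.

Arguments box {R} n r.

(** * Lebesgue measure under linear maps *)

Section lebesgue_rV_linear.
Variable R : realType.
Local Open Scope ereal_scope.
Local Notation leb n := (@lebesgue_rV R n).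

Lemma mule_fin_inj (x y : \bar R) (r : R) :
  r != 0%R -> x * r%:E = y * r%:E -> x = y.
Proof.
move=> r0 /(congr1 (fun z => z * (r^-1)%:E)).
by rewrite -!muleA -!EFinM divff// !mule1.
Qed.

(* Uniqueness of Haar measure: Tonelli's theorem for the set of all (y, x) with
   y in F and y + x M in E, translating by x M in between. *)
Lemma lebesgue_rV_linear n (M : 'M[R]_n) (E F : set 'rV[R]_n) :
  M \in unitmx -> measurable E -> measurable F ->
  leb n [set x | E (x *m M)] * leb n F =
  leb n E * leb n [set x | F (- (x *m M))%R].
Proof.
move=> uM mE mF.
have mlin (A : set 'rV[R]_n) f :
    measurable_fun setT f -> measurable A ->
    measurable [set x : 'rV[R]_n | A (f x : 'rV[R]_n)].
  by move=> mf; exact: measurable_preimage.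
have mL : measurable [set x | E (x *m M)] by apply: mlin => //;
  exact: measurable_mulmx.
have mRt : measurable [set x | F (- (x *m M))%R].
  by apply: mlin => //; apply: measurable_opp_rV; exact: measurable_mulmx.
have mp2M : measurable_fun setT (fun p : 'rV[R]_n * 'rV[R]_n => (p.2 *m M)).
  by apply: measurable_mulmx; exact: measurable_snd.
have mp1 : measurable_fun setT (fun p : 'rV[R]_n * 'rV[R]_n => p.1).
  exact: measurable_fst.
have mS : measurable [set p : 'rV[R]_n * 'rV[R]_n |
    F p.1 /\ E (p.1 + p.2 *m M)%R].
  apply: measurableI; first exact: (measurable_preimage mp1).
  exact: (measurable_preimage (measurable_add_rV mp1 mp2M)).
have mS' : measurable [set p : 'rV[R]_n * 'rV[R]_n |
    E p.1 /\ F (p.1 - p.2 *m M)%R].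
  apply: measurableI; first exact: (measurable_preimage mp1).
  exact: (measurable_preimage (measurable_add_rV mp1 (measurable_opp_rV mp2M))).
(* The fibre over y in [F] is the translate by y M^-1 of the set of x with x M in [E], so all fibres
   have the same measure. The other product is treated likewise. *)
rewrite -(integral_section_cst (leb n) (m2 := leb n)
  (G := fun y => [set x | E (y + x *m M)%R]) mF); last first.
  move=> y _; rewrite -(lebesgue_rV_translate (y *m invmx M) mL).
  by congr (leb n _); apply/funext => x /=; rewrite mulmxDl mulmxKV// addrC.
rewrite muleC -(integral_section_cst (leb n) (m2 := leb n)
  (G := fun z => [set x | F (z - x *m M)%R]) mE); last first.
  move=> z _; rewrite -(lebesgue_rV_translate (- (z *m invmx M))%R mRt).
  by congr (leb n _); apply/funext => x /=;
    rewrite mulmxDl mulNmx mulmxKV// opprD opprK addrC.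
rewrite (integral_sections (leb n) (leb n) mS).
rewrite (integral_sections (leb n) (leb n) mS').
apply: eq_integral => x _ /=.
have mx : measurable [set y | E y /\ F (y - x *m M)%R].
  by apply: measurableI => //; exact: measurable_translate.
(* For fixed x, the translation y -> y + x M carries one section onto the other. *)
rewrite -(lebesgue_rV_translate (x *m M) mx).
by congr (leb n _); apply/funext => y /=; rewrite addrK propeqE; split => -[].
Qed.

Lemma dot_mulmx n (x y : 'rV[R]_n) : dot x y = (x *m y^T) ord0 ord0.
Proof. by rewrite mxE; apply: eq_bigr => i _; rewrite mxE. Qed.

Lemma dotZl n (c : R) (x y : 'rV[R]_n) : (dot (c *: x) y = c * dot x y)%R.
Proof. by rewrite !dot_mulmx -scalemxAl mxE. Qed.

Lemma dotC n (x y : 'rV[R]_n) : dot x y = dot y x.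
Proof. by apply: eq_bigr => i _; rewrite mulrC. Qed.

Lemma dot_ge0 n (x : 'rV[R]_n) : (0 <= dot x x)%R.
Proof. by apply: sumr_ge0 => i _; rewrite -expr2 sqr_ge0. Qed.

Lemma dotNN n (x y : 'rV[R]_n) : (dot (- x) (- y) = dot x y)%R.
Proof. by apply: eq_bigr => i _; rewrite !mxE mulrNN. Qed.

(** In [lebesgue_rV_linear], take for [F] the Euclidean unit ball: it is preserved by [M] and by the
    sign change, and its measure, positive and finite, cancels. *)
Lemma lebesgue_rV_orthogonal n (M : 'M[R]_n) (E : set 'rV[R]_n) :
  M *m M^T = 1%:M -> measurable E ->
  leb n [set x | E (x *m M)] = leb n E.
Proof.
move=> MM mE; have uM : M \in unitmx by case/mulmx1_unit: MM.
pose F := [set x : 'rV[R]_n | (dot x x <= 1)%R].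
have mF : measurable F.
  rewrite (_ : F = (fun x => dot x x) @^-1` `]-oo, 1%R]%classic); last first.
    by apply/seteqP; split => x; rewrite /F /= in_itv.
  apply: measurable_preimage => //.
  by apply: measurable_sum => i; apply: measurable_funM;
    exact: measurable_coord_rV.
have FM : [set x | F (- (x *m M))%R] = F.
  apply/funext => x; rewrite /F /=; congr (is_true (_ <= _)%R).
  by rewrite dotNN !dot_mulmx trmx_mul mulmxA -(mulmxA x) MM mulmx1.
have F1 : F `<=` box n 1%R.
  move=> x /= Fx i; rewrite -(@ler_pXn2r _ 2)// ?nnegrE// expr1n real_normK
    ?num_real//.
  apply: le_trans Fx; rewrite /dot (bigD1 i)//= expr2 lerDl.
  by apply: sumr_ge0 => j _; rewrite -expr2 sqr_ge0.
(* Each coordinate is at most 1/(n+1) <= 1 in absolute value, hence so is its square, and the n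
   squares add up to at most n/(n+1). *)
have F2 : box n (n.+1%:R^-1) `<=` F.
  move=> x /= bx; apply: (@le_trans _ _ (\sum_(i < n) n.+1%:R^-1)%R).
    apply: ler_sum => i _; rewrite -expr2 -real_normK ?num_real//.
    rewrite -[leRHS]mulr1 expr2 ler_pM// (le_trans (bx i))//.
    by rewrite invf_le1 ?ler1n.
  by rewrite sumr_const card_ord -[leLHS]mulr_natr mulrC ler_pdivrMr// mul1r
    ler_nat.
have F_lty : leb n F < +oo.
  apply: (@le_lt_trans _ _ (leb n (box n 1%R)));
    last by rewrite lebesgue_rV_box// ltry.
  by apply: le_measure => //; rewrite inE//; exact: measurable_box.
have F_gt0 : 0 < leb n F.
  apply: (@lt_le_trans _ _ (leb n (box n n.+1%:R^-1%R))).
    by rewrite lebesgue_rV_box// lte_fin exprn_gt0// pmulrn_lgt0.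
  by apply: le_measure => //; rewrite inE//; exact: measurable_box.
have Ffin : leb n F \is a fin_num by rewrite ge0_fin_numE.
have := lebesgue_rV_linear uM mE mF; rewrite FM -(fineK Ffin) => /mule_fin_inj;
  apply.
by rewrite gt_eqF// fine_gt0// F_gt0.
Qed.

(** [lebesgue_rV_linear] for a scalar matrix, tested on the cubes of half-sides 1 and 1/c, whose
    measures have ratio c^n. *)
Lemma lebesgue_rV_scale n (c : R) (E : set 'rV[R]_n) :
  (0 < c)%R -> measurable E ->
  leb n [set x | E (c *: x)%R] = (c ^- n)%:E * leb n E.
Proof.
move=> c0 mE.
have uM : (c%:M : 'M[R]_n) \in unitmx by rewrite unitmxE det_scalar unitrX//
  unitfE gt_eqF.
have := lebesgue_rV_linear uM mE (measurable_box (n:=n) 1%R).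
rewrite (_ : [set x | E (x *m c%:M)] = [set x | E (c *: x)%R]); last first.
  by apply/funext => x /=; rewrite mul_mx_scalar.
rewrite (_ : [set x | box n 1 (- (x *m c%:M))%R] = box n c^-1%R); last first.
  apply/funext => x /=; rewrite propeqE; split => h i; have := h i;
  by rewrite mul_mx_scalar !mxE normrN normrM (gtr0_norm c0) -ler_pdivlMl//
    mulr1.
rewrite !lebesgue_rV_box ?invr_ge0 ?(ltW c0)// => H.
apply: (@mule_fin_inj _ _ ((1 *+ 2) ^+ n)%R).
  by rewrite expf_neq0// pnatr_eq0.
rewrite H [in RHS]muleAC -EFinM muleC; congr (_%:E * _).
by rewrite -(mulr_natr c^-1) exprMn exprVn.
Qed.

End lebesgue_rV_linear.

(** * Chords and projections *)

Section orthonormal_frame.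
Variables (R : realType) (m : nat).
Implicit Types u v w : 'rV[R]_m.+1.

Lemma mulmx_tr_dot v w : v *m w^T = (dot v w)%:M.
Proof.
by apply/matrixP => i j; rewrite !ord1 dot_mulmx [RHS]mxE eqxx mulr1n.
Qed.

(* The Householder reflection exchanging the first basis vector and u. *)
Lemma orthogonal_extension u : dot u u = 1 ->
  exists2 H : 'M[R]_m.+1, H *m H^T = 1%:M & row ord0 H = u.
Proof.
move=> uu; pose e : 'rV[R]_m.+1 := delta_mx 0 ord0.
(* When u = e the reflection vector vanishes, and the identity serves instead. *)
have [ue|ue] := eqVneq u e.
  by exists 1%:M; [rewrite trmx1 mulmx1|rewrite ue rowE mulmx1].
pose v := u - e; pose c := dot v v.
have ev : dot e v = u ord0 ord0 - 1.
  rewrite /dot (bigD1 ord0)//= big1 => [|i i0];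
    last by rewrite !mxE eq_sym (negbTE i0) andbF mul0r.
  by rewrite !mxE !eqxx mul1r addr0.
have cE : c = 2 * (1 - u ord0 ord0).
  have ee : dot e e = 1.
    rewrite /dot (bigD1 ord0)//= big1 => [|i i0];
      first by rewrite !mxE !eqxx mul1r addr0.
    by rewrite !mxE (negbTE i0) andbF mul0r.
  have eu : dot e u = u ord0 ord0.
    rewrite /dot (bigD1 ord0)//= big1 => [|i i0];
      first by rewrite !mxE !eqxx mul1r addr0.
    by rewrite !mxE (negbTE i0) andbF mul0r.
  have -> : c = dot u u - 2 * dot e u + dot e e.
    rewrite /c /dot mulr_sumr -sumrB -big_split /=; apply: eq_bigr => i _.
    have -> : v ord0 i = u ord0 i - e ord0 i.
      by rewrite [LHS]mxE; congr (_ + _); rewrite mxE.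
    by move: (e ord0 i) => ei; ring.
  by rewrite uu ee eu; ring.
have c0 : c != 0.
  apply: contra_neq ue => /eqP; rewrite /c /dot psumr_eq0 => [|i _];
    last by rewrite -expr2 sqr_ge0.
  move=> /allP v0; apply/eqP; rewrite -subr_eq0; apply/eqP/rowP => i.
  by have := v0 i (mem_index_enum _); rewrite -expr2 sqrf_eq0 => /eqP ->;
    rewrite mxE.
pose H := 1%:M - (2 / c) *: (v^T *m v).
have HT : H^T = H by rewrite /H linearB /= linearZ /= trmx_mul trmxK trmx1.
exists H; last first.
  rewrite rowE -/e /H mulmxBr mulmx1 -scalemxAr mulmxA mulmx_tr_dot
    mul_scalar_mx scalerA ev.
  (* The coefficient is 2 (u_0 - 1) / c with c = 2 (1 - u_0), so that e H = e + v = u. *)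
  rewrite (_ : _ * _ = -1); last by rewrite cE in c0 *; field; move: c0;
    rewrite mulf_eq0 negb_or => /andP[].
  by rewrite scaleN1r opprK /v addrC subrK.
(* With P = v^T v and P P = c P, the terms -(4/c) P and (4/c^2) c P of the square of [H] cancel. *)
have PP : (v^T *m v) *m (v^T *m v) = c *: (v^T *m v).
  by rewrite -mulmxA (mulmxA v) mulmx_tr_dot mul_scalar_mx -scalemxAr.
rewrite HT /H; move: (v^T *m v) PP => P PP.
rewrite mulmxBl mul1mx mulmxBr mulmx1 -scalemxAl -scalemxAr PP !scalerA.
rewrite (_ : 2 / c * (2 / c) * c = 2 / c + 2 / c); last by field.
by rewrite scalerDl opprB addrK subrK.
Qed.

(** The [xget] has a witness: the rows other than the first of an orthogonal matrix whose first row
    is [u]. *)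
Lemma perp_frameP u : dot u u = 1 ->
  perp_frame u *m (perp_frame u)^T = 1%:M /\ perp_frame u *m u^T = 0.
Proof.
move=> /orthogonal_extension[H HH Hu].
have : exists B : 'M[R]_(m, m.+1), B *m B^T = 1%:M /\ B *m u^T = 0.
  have HHij i j : (row i H *m (row j H)^T) ord0 ord0 = (i == j)%:R.
    rewrite tr_row; have := congr1 (fun A : 'M[R]_(m.+1) => A i j) HH.
    by rewrite !mxE => <-; apply: eq_bigr => k _; rewrite !mxE.
  exists (row' ord0 H); split.
    apply/matrixP => i j; rewrite [RHS]mxE -(inj_eq (@lift_inj _ ord0)) -HHij
      !mxE.
    by apply: eq_bigr => k _; rewrite !mxE.
  apply/matrixP => i j; rewrite ord1 [RHS]mxE.
  transitivity ((row (lift ord0 i) H *m (row ord0 H)^T) ord0 ord0);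
    last by rewrite HHij.
  rewrite Hu !mxE.
  by apply: eq_bigr => k _; rewrite !mxE.
exact: xgetPex.
Qed.

(** Coordinates adapted to [u]: the first runs along [u], the others are those in which [vol_perp]
    reads the hyperplane. *)
Definition frame_mx u : 'M[R]_m.+1 :=
  \matrix_i (if unlift ord0 i is Some j then row j (perp_frame u) else u).

Lemma mul_cons_frame u (s : R) (w : 'rV[R]_m) :
  cons_rV s w *m frame_mx u = s *: u + w *m perp_frame u.
Proof.
rewrite mul_cons_rV.
have -> : row ord0 (frame_mx u) = u by apply/rowP => j;
  rewrite !mxE unlift_none.
have -> // : row' ord0 (frame_mx u) = perp_frame u.
by apply/matrixP => i j; rewrite !mxE liftK mxE.
Qed.

Lemma frame_mx_orthogonal u :
  dot u u = 1 -> frame_mx u *m (frame_mx u)^T = 1%:M.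
Proof.
move=> uu; have [BB Bu] := perp_frameP uu.
apply/row_matrixP => i; rewrite row_mul rowK row1.
have uB : u *m (perp_frame u)^T = 0 by rewrite -[LHS]trmxK trmx_mul trmxK Bu
  trmx0.
case: (unliftP ord0 i) => [j|] ->.
  apply/rowP => k; rewrite !mxE; case: (unliftP ord0 k) => [l|] ->.
    transitivity ((perp_frame u *m (perp_frame u)^T) j l).
      by rewrite mxE; apply: eq_bigr => p _; rewrite !mxE liftK mxE.
    by rewrite BB mxE (inj_eq (@lift_inj _ ord0)) eqxx eq_sym.
  transitivity ((perp_frame u *m u^T) j ord0); last by rewrite Bu mxE.
  by rewrite mxE; apply: eq_bigr => p _; rewrite !mxE unlift_none.
apply/rowP => k; rewrite !mxE; case: (unliftP ord0 k) => [l|] ->.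
  transitivity ((u *m (perp_frame u)^T) ord0 l); last by rewrite uB mxE.
  by rewrite mxE; apply: eq_bigr => p _; rewrite !mxE liftK mxE.
by rewrite !eqxx -[RHS]uu; apply: eq_bigr => p _; rewrite !mxE unlift_none.
Qed.

End orthonormal_frame.

(** * Chord lengths and cones over a projection *)

Section cone.
Variables (R : realType) (m : nat).
Local Open Scope ereal_scope.
Local Notation mu1 := (@lebesgue_measure R).
Local Notation leb n := (@lebesgue_rV R n).

Lemma measurable_frame (u : 'rV[R]_m.+1) :
  measurable_fun setT (fun p : measurableTypeR R * 'rV[R]_m =>
    (p.1 *: u + p.2 *m perp_frame u)%R).
Proof.
apply: measurable_add_rV.
  by apply: measurable_scale_rV => //; exact: measurable_fst.
by apply: measurable_mulmx; exact: measurable_snd.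
Qed.

(** The volume is the integral of the lengths of the chords parallel to [u]: rotate to the frame,
    slice, and exchange the integrals. *)
Lemma lebesgue_rV_frame (u : 'rV[R]_m.+1) (K : set 'rV[R]_m.+1) :
  dot u u = 1%R -> measurable K ->
  leb m.+1 K =
  \int[leb m]_w mu1 [set s | K (s *: u + w *m perp_frame u)%R].
Proof.
move=> uu mK; rewrite -(lebesgue_rV_orthogonal (frame_mx_orthogonal uu) mK)
  lebesgue_rVS.
rewrite -(integral_sections mu1 (leb m)
  (measurable_preimage (measurable_frame u) mK)).
by apply: eq_integral => s _; congr (leb m _); apply/funext => w /=;
  rewrite mul_cons_frame.
Qed.

Lemma integral_onemXn n :
  \int[mu1]_(x in `[0%R, 1%R]) ((1 - x) ^+ n)%:E = (n.+1%:R^-1)%:E.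
Proof.
rewrite -Rintegral_onemXn /Rintegral fineK; first exact: eq_integral.
apply: integrable_fin_num => //.
have := @integrable_XMonemX R 0 n.
by apply: eq_integrable => // x _ /=; rewrite XMonemX0n.
Qed.

(** The homothety is the dilation about 0 conjugated by the translation that brings [w0] to 0. *)
Lemma lebesgue_homothety (w0 : 'rV[R]_m) (c : R) (A : set 'rV[R]_m) :
  (0 < c)%R -> measurable A ->
  leb m [set w | A (w0 + c *: (w - w0))%R] = (c ^- m)%:E * leb m A.
Proof.
move=> c0 mA.
have mA' : measurable [set w | A (w + w0)%R] by exact: measurable_translate.
have mA'' : measurable [set w | A (c *: w + w0)%R].
  apply: (measurable_preimage (f := fun w : 'rV[R]_m => (c *: w)%R)
    (A := [set w | A (w + w0)%R])) => //.
  exact: measurable_scale_rV.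
rewrite -(lebesgue_rV_translate w0 mA) -lebesgue_rV_scale//.
rewrite -(lebesgue_rV_translate (- w0)%R mA'').
by congr (leb m _); apply/funext => w /=; rewrite addrC.
Qed.

(** The factor 1/(1 - t) is written as a real power, whose measurability is given by
    [measurable_powR]. Leaving out t = 1 keeps 1 - t positive, where the power is the inverse. *)
Lemma measurable_cone (w0 : 'rV[R]_m) (A : set 'rV[R]_m) : measurable A ->
  measurable [set p : measurableTypeR R * 'rV[R]_m |
    `[0%R, 1%R[%classic p.1 /\ A (w0 + (1 - p.1) `^ (-1) *: (p.2 - w0))%R].
Proof.
move=> mA; apply: measurableI.
  apply: (measurable_preimage (f := fun p : measurableTypeR R * 'rV[R]_m => p.1)
    (A := `[0%R, 1%R[%classic)) => //; exact: measurable_fst.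
apply: (measurable_preimage (f := fun p : measurableTypeR R * 'rV[R]_m =>
  (w0 + (1 - p.1) `^ (-1) *: (p.2 - w0) : 'rV[R]_m)%R)) => //.
apply: measurable_add_rV => //; apply: measurable_scale_rV.
  apply: (measurableT_comp (measurable_powR (R := R) (-1)%R)).
  by apply: measurable_funB => //; exact: measurable_fst.
by apply: measurable_add_rV => //; exact: measurable_snd.
Qed.

(** The slice at height t is the copy of [A] shrunk towards [w0] by the ratio 1 - t, of measure (1 -
    t)^m times that of [A]; integrate over t. *)
Lemma cone_volume (w0 : 'rV[R]_m) (A : set 'rV[R]_m) : measurable A ->
  \int[leb m]_w mu1 [set t | `[0%R, 1%R[%classic t /\
    A (w0 + (1 - t) `^ (-1) *: (w - w0))%R] = (m.+1%:R^-1)%:E * leb m A.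
Proof.
move=> mA; rewrite -(integral_sections mu1 (leb m) (measurable_cone w0 mA)).
rewrite -(integral_onemXn m) -integral_itv_bndo_bndc; last first.
  apply/measurable_EFinP; apply: measurable_funTS; apply: measurable_funX.
  exact: measurable_funB.
rewrite -ge0_integralZr//; first last.
- by move=> x /=; rewrite in_itv/= => /andP[_ x1];
  rewrite lee_fin exprn_ge0// subr_ge0 ltW.
- apply/measurable_EFinP; apply: measurable_funTS; apply: measurable_funX.
  exact: measurable_funB.
rewrite [RHS]integral_mkcond; apply: eq_integral => t _; rewrite patchE.
case: ifPn => [|tN].
  rewrite inE/= in_itv/= => /andP[t0 t1].
  rewrite -[X in (X ^+ m)%R]invrK exprVn -(lebesgue_homothety w0) ?invr_gt0
    ?subr_gt0//.
  congr (leb m _); apply/funext => w /=;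
    rewrite powR_inv1 ?subr_ge0 ?(ltW t1)//.
  by rewrite propeqE; split => [[]//|H]; rewrite t0 t1.
transitivity (leb m set0); last exact: measure0.
by move: tN; rewrite notin_setE => tN; congr (leb m _);
  rewrite -subset0 => w [/tN].
Qed.

(** The projection of [K] along [u], in the coordinates of [perp_frame]. *)
Definition shadow (u : 'rV[R]_m.+1) (K : set 'rV[R]_m.+1) : set 'rV[R]_m :=
  [set w | exists s : R, K (s *: u + w *m perp_frame u)%R].

(* The cone with apex w0 is parametrized by the ratio t, so that its fibre over
   w is contained in [0, |chord of K over w| / (al - be)]. *)
Lemma shadow_bound (u : 'rV[R]_m.+1) (K : set 'rV[R]_m.+1) (w0 : 'rV[R]_m)
    (al be : R) :
  dot u u = 1%R -> measurable K -> measurable (shadow u K) ->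
  (forall x y (t : R), (0 <= t <= 1)%R ->
    K x -> K y -> K (t *: x + (1 - t) *: y)%R) ->
  K (al *: u + w0 *m perp_frame u)%R -> K (be *: u + w0 *m perp_frame u)%R ->
  (be < al)%R ->
  (al - be)%:E * leb m (shadow u K) <= m.+1%:R%:E * leb m.+1 K.
Proof.
move=> uu mK mS cK Ka Kb ab.
pose L := (al - be)%R; have L0 : (0 < L)%R by rewrite subr_gt0.
suff : L%:E * ((m.+1%:R^-1)%:E * leb m (shadow u K)) <= leb m.+1 K.
  have m0 : 0 <= m.+1%:R%:E :> \bar R by rewrite lee_fin.
  move=> /(lee_wpmul2l m0).
  by rewrite muleCA (muleA m.+1%:R%:E) -EFinM mulfV// mul1e.
rewrite -(cone_volume w0 mS) (lebesgue_rV_frame uu mK).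
have mc := measurable_cone w0 mS.
rewrite -ge0_integralZl//; last 2 first.
- exact: measurable_fun_section mc.
- by rewrite lee_fin ltW.
apply: ge0_le_integral => //.
- by move=> w _; rewrite mule_ge0// lee_fin ltW.
- apply: measurable_funeM; exact: measurable_fun_section mc.
- exact: (measurable_fun_section mu1
  (measurable_preimage (measurable_frame u) mK)).
move=> w _.
set A := [set s | K _]; set T := [set t | _ /\ _].
have mA : measurable A.
  exact: (measurable_preimage (measurable_fun_pair1 w (measurable_frame u)) mK).
(* Here w = w0 + (1 - t)(p - w0), with a point of [K] at height s over p. Combining it, with weight
   1 - t, with the two given points over [w0], with weight t, yields two points of [K] over w at
   distance L t; the segment between them lies in [K]. *)
have TA t : T t -> (L * t)%:E <= mu1 A.
  move=> [] /=; rewrite in_itv/= => /andP[t0 t1];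
    rewrite powR_inv1 ?subr_ge0 ?(ltW t1)// => -[s Ks].
  have t01 : (0 <= t <= 1)%R by rewrite t0 ltW.
  have t'0 : (1 - t)%R != 0%R by rewrite subr_eq0 gt_eqF.
  have AI x : K (x *: u + w0 *m perp_frame u)%R -> A (t * x + (1 - t) * s)%R.
    move=> Kx; have := cK _ _ _ t01 Kx Ks; congr (K _).
    rewrite mulmxDl -scalemxAl mulmxBl.
    move: (w0 *m _) (w *m _) => a b; apply/rowP => i; rewrite !mxE.
    by field.
  have <- : mu1 `[(t * be + (1 - t) * s)%R,
    (t * al + (1 - t) * s)%R]%classic = (L * t)%:E.
    rewrite lebesgue_measure_itv/= lte_fin ltrD2r; case: ifPn => [_|].
      by rewrite -EFinB; congr (_%:E); rewrite /L; ring.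
    rewrite -leNgt => tab; suff -> : t = 0%R by rewrite mulr0.
    apply/le_anti; rewrite t0 andbT leNgt; apply/negP => t0'.
    by move: tab; rewrite ler_pM2l// leNgt ab.
  apply: le_measure; rewrite ?inE//.
  move=> x /=; rewrite in_itv/= => /andP[x1 x2].
  pose y := (x - (t * be + (1 - t) * s))%R.
  pose z := (t * al + (1 - t) * s - x)%R.
  (* At t = 0 the segment is a single point; otherwise x divides it with weight y / (L t). *)
  have [t00|tn0] := eqVneq t 0%R.
    have := AI _ Ka; rewrite (_ : _ + _ = x)%R//.
    by apply/le_anti/andP; split; move: x1 x2; rewrite t00 !mul0r; lra.
  have Lt0 : (L * t)%R != 0%R by rewrite mulf_neq0// gt_eqF.
  have yz : (y + z = L * t)%R by rewrite /y /z /L; ring.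
  have k01 : (0 <= y / (L * t) <= 1)%R.
    have Lt : (0 < L * t)%R by rewrite mulr_gt0// lt_neqAle eq_sym tn0.
    rewrite divr_ge0 ?(ltW Lt) ?subr_ge0//= ler_pdivrMr// mul1r -yz lerDl
      subr_ge0//.
  have := cK _ _ _ k01 (AI _ Ka) (AI _ Kb); congr (K _).
  move: (w *m _) => b; apply/rowP => i; rewrite !mxE /y /L.
  by field; rewrite tn0 subr_eq0 gt_eqF.
(* [K] is not assumed bounded here; a chord of infinite length bounds anything. *)
have [Afin|] := boolP (mu1 A < +oo); last by rewrite -leNgt leye_eq => /eqP ->;
  exact: leey.
have {}Afin : mu1 A \is a fin_num by rewrite ge0_fin_numE.
have TI : T `<=` `[0%R, (fine (mu1 A) / L)%R]%classic.
  move=> t Tt; rewrite /= in_itv/=; have [/= + _] := Tt.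
  rewrite in_itv/= => /andP[-> _] /=.
  by rewrite ler_pdivlMr// mulrC -lee_fin fineK// TA.
have mT : measurable T.
  have := measurable_ysection w mc; by rewrite ysectionE.
apply: (@le_trans _ _ (L%:E * mu1 `[0%R, (fine (mu1 A) / L)%R]%classic)).
  by rewrite lee_wpmul2l ?lee_fin ?(ltW L0)//; apply: le_measure; rewrite ?inE.
rewrite lebesgue_measure_itv/= lte_fin; case: ifPn => _; last first.
  by rewrite mule0 measure_ge0.
by rewrite sube0 -EFinM mulrC divfK ?gt_eqF// fineK.
Qed.

End cone.

Section nonmeasurable_integrand.
Local Open Scope ereal_scope.
Context d (T : measurableType d) (R : realType).
Variable mu : {measure set T -> \bar R}.

(* [ge0_le_integral] without measurability: it spares us the measurability of
   y |-> mu (y - K). *)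
Lemma ge0_le_integral_nomeas (f g : T -> \bar R) :
  (forall x, 0 <= f x) -> (forall x, f x <= g x) ->
  \int[mu]_x f x <= \int[mu]_x g x.
Proof.
move=> f0 fg; have g0 x : 0 <= g x by apply: le_trans (fg x).
(* The integral of a nonnegative function is a supremum over the simple functions below it, and
   those below f are below g. *)
rewrite !ge0_integralTE//; apply: ereal_sup_le => _ [h hf <-].
by exists h => // x; exact: le_trans (hf x) (fg x).
Qed.

End nonmeasurable_integrand.

(** * Continuity, support functions and volumes of compact sets *)

Section topology.
Variable R : realType.

Lemma continuous_rV (T : topologicalType) n (f : T -> 'rV[R]_n) :
  (forall i, continuous (fun x => f x ord0 i)) -> continuous f.
Proof.
move=> cf x; apply/cvg_ballP => e e0.
have : \forall y \near x, forall i, ball (f x ord0 i) e (f y ord0 i).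
  by apply: filter_forall => i; exact: (cvg_ball (cf i x)).
by apply: filterS => y fxy; split => // i j; rewrite (ord1 i).
Qed.

Lemma continuous_mulmx n m (M : 'M[R]_(n, m)) :
  continuous (fun x : 'rV[R]_n => x *m M).
Proof.
apply: continuous_rV => i; under eq_fun do rewrite mxE.
apply: continuous_big => [|k _]; first exact: add_continuous.
move=> x; apply: continuousM;
  [exact: (@coord_continuous R 1 n ord0 k x)|exact: cst_continuous].
Qed.

Lemma continuous_dotl n (y : 'rV[R]_n) : continuous (fun x => dot x y).
Proof.
apply: continuous_big => [|k _]; first exact: add_continuous.
move=> x; apply: continuousM;
  [exact: (@coord_continuous R 1 n ord0 k x)|exact: cst_continuous].
Qed.

Lemma continuous_dotr n (y : 'rV[R]_n) : continuous (fun x => dot y x).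
Proof.
apply: continuous_big => [|k _]; first exact: add_continuous.
move=> x; apply: continuousM;
  [exact: cst_continuous|exact: (@coord_continuous R 1 n ord0 k x)].
Qed.

End topology.

Section convexity.
Variables (R : realType) (n : nat).
Implicit Types K P : set 'rV[R]_n.

Lemma convex_setP K : convex_set K -> forall x y (t : R), 0 <= t <= 1 ->
  K x -> K y -> K (t *: x + (1 - t) *: y).
Proof.
move=> cK x y t /andP[t0 t1] Kx Ky.
have := cK x y (Itv01 t0 t1); rewrite !inE; exact.
Qed.

(** Compactness bounds the values of the linear form, so that the real [sup] is a genuine supremum
    and not a default value. *)
Lemma support_function_ub P x y :
  compact P -> P y -> dot x y <= support_function P x.
Proof.
move=> cP Py; apply: ub_le_sup; last by exists y.
have : compact [set dot x y | y in P].
  apply: continuous_compact => //; apply: continuous_subspaceT => z;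
    exact: continuous_dotr.
move=> /compact_bounded[M [_ /(_ (M + 1))]]; rewrite ltrDl ltr01 => /(_ isT) h.
by exists (M + 1) => z /h; apply: le_trans; exact: ler_norm.
Qed.

End convexity.

Section compact_measure.
Variables (R : realType) (n : nat).
Implicit Types K : set 'rV[R]_n.
Local Open Scope ereal_scope.

Lemma compact_sub_box K :
  compact K -> exists2 r : R, (0 < r)%R & K `<=` box n r.
Proof.
move=> /compact_bounded[M [_ hM]]; exists (`|M| + 1)%R;
  first by rewrite ltr_wpDl.
move=> x Kx i; apply: (@le_trans _ _ `|x|%R).
  by rewrite [leRHS]mx_normrE; exact: (le_bigmax _ (fun ij =>
    `|x ij.1 ij.2|%R) (ord0, i)).
by apply: hM => //; rewrite (le_lt_trans (ler_norm _))// ltrDl.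
Qed.

Lemma compact_lebesgue_lty K : compact K -> lebesgue_rV K < +oo.
Proof.
move=> cK; have [r r0 Kr] := compact_sub_box cK.
apply: (@le_lt_trans _ _ (lebesgue_rV (box n r)));
  last by rewrite lebesgue_rV_box ?ltry// ltW.
by apply: le_measure => //; rewrite inE;
  [exact: compact_measurable_rV|exact: measurable_box].
Qed.

Lemma lebesgue_rV_vol K : compact K -> lebesgue_rV K = (vol K)%:E.
Proof. by move=> cK; rewrite fineK// ge0_fin_numE// compact_lebesgue_lty. Qed.

Lemma closed_box_ball (x : 'rV[R]_n) (r : R) : (0 < r)%R ->
  [set y | box n (r / 2) (y - x)%R] `<=` ball x r.
Proof.
move=> r0 y xy; split => // i j; rewrite (ord1 i) /ball /= distrC.
have := xy j; rewrite !mxE => /le_lt_trans; apply.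
by rewrite ltr_pdivrMr// ltr_pMr// ltr1n.
Qed.

(** The interior contains a cube, and compactness makes the measure finite, so that [fine] loses
    nothing. *)
Lemma vol_gt0 K : compact K -> K^° !=set0 -> (0 < vol K)%R.
Proof.
move=> cK [x]; rewrite /interior => /nbhs_ballP[e /= e0 eK].
rewrite -lte_fin -lebesgue_rV_vol//.
have e20 : (0 < e / 2)%R by rewrite divr_gt0.
apply: (@lt_le_trans _ _ (lebesgue_rV [set y | box n (e / 2) (y - x)%R])).
  rewrite lebesgue_rV_translate; last exact: measurable_box.
  by rewrite lebesgue_rV_box ?(ltW e20)// lte_fin exprn_gt0// pmulrn_lgt0.
apply: le_measure; rewrite ?inE.
- by apply: measurable_translate; exact: measurable_box.
- exact: compact_measurable_rV.
- by apply: subset_trans eK; exact: closed_box_ball.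
Qed.

End compact_measure.

(** * The bound on the support function of the projection body *)

Section projection.
Variables (R : realType) (m : nat).
Implicit Types (K P : set 'rV[R]_m.+1) (u : 'rV[R]_m.+1).

Lemma mulmx_tr_frame u s (w : 'rV[R]_m) : dot u u = 1 ->
  (s *: u + w *m perp_frame u) *m (perp_frame u)^T = w.
Proof.
move=> uu; have [BB Bu] := perp_frameP uu.
rewrite mulmxDl -scalemxAl -mulmxA BB mulmx1 -[u *m _]trmxK trmx_mul trmxK Bu.
by rewrite trmx0 scaler0 add0r.
Qed.

Lemma frame_decomposition u x : dot u u = 1 ->
  dot x u *: u + x *m (perp_frame u)^T *m perp_frame u = x.
Proof.
move=> uu; have MM : (frame_mx u)^T *m frame_mx u = 1%:M.
  by apply: mulmx1C; exact: frame_mx_orthogonal.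
rewrite -[RHS]mulmx1 -MM mulmxA [X in _ = X *m _]cons_rVE mul_cons_frame.
congr (_ *: _ + _); last congr (_ *m _).
  by rewrite mxE; apply: eq_bigr => i _; rewrite !mxE unlift_none.
apply/rowP => j; rewrite !mxE; apply: eq_bigr => i _.
by rewrite !mxE liftK mxE.
Qed.

(** Exhibits the shadow as a linear image of [K], whence its compactness and measurability. *)
Lemma shadow_image u K : dot u u = 1 ->
  shadow u K = (fun x => x *m (perp_frame u)^T) @` K.
Proof.
move=> uu; apply/seteqP; split => [w [s Ks]|_ [x Kx <-]] /=.
  by exists (s *: u + w *m perp_frame u); rewrite ?mulmx_tr_frame.
by exists (dot x u); rewrite frame_decomposition.
Qed.

Lemma compact_shadow u K : dot u u = 1 -> compact K -> compact (shadow u K).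
Proof.
move=> uu cK; rewrite shadow_image//; apply: continuous_compact => //.
by apply: continuous_subspaceT => x; exact: continuous_mulmx.
Qed.

(** The projection removes exactly the component along [u], so w B lies in the projection, B being
    the frame, iff some s u + w B lies in [K]. *)
Lemma vol_perp_shadow u K : dot u u = 1 ->
  vol_perp u [set proj_perp u x | x in K] = vol (shadow u K).
Proof.
move=> uu; have [BB Bu] := perp_frameP uu; congr vol.
have dotB w : dot (w *m perp_frame u) u = 0.
  by rewrite dot_mulmx -mulmxA Bu mulmx0 mxE.
have dotl s x y : dot (s *: u + x) y = s * dot u y + dot x y.
  by rewrite !dot_mulmx mulmxDl mxE -scalemxAl mxE.
apply/seteqP; split => w /= [].
  move=> x Kx xE; exists (dot x u); rewrite -xE /proj_perp addrC subrK//.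
move=> s Ks; exists (s *: u + w *m perp_frame u) => //.
by rewrite /proj_perp dotl dotB uu mulr1 addr0 addrC addKr.
Qed.

(** Write a - b = L u with u a unit vector. By homogeneity the left side is at most L times the
    volume of the shadow, and [shadow_bound] applies to the segment from b to a. *)
Lemma difference_support K P a b : convex_body K -> is_projection_body K P ->
  K a -> K b -> support_function P (a - b) <= m.+1%:R * vol K.
Proof.
move=> [cK /convex_setP vK iK] [[cP _ iP] PE] Ka Kb.
have [p Pp] : P !=set0 by case: iP => p /interior_subset; exists p.
have volK0 := vol_gt0 cK iK.
have ge_sup_dot x c :
    (forall y, P y -> dot x y <= c) -> support_function P x <= c.
  move=> h; apply: ge_sup; first by exists (dot x p), p.
  by move=> _ [y Py <-]; exact: h.
(* If a = b there is no direction u, but then the support function is taken at 0. *)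
have [->|ab] := eqVneq a b.
  rewrite subrr; apply: ge_sup_dot => y Py.
  by rewrite dot_mulmx mul0mx mxE mulr_ge0// ltW.
pose d := a - b; pose L := Num.sqrt (dot d d).
have L0 : 0 < L.
  rewrite sqrtr_gt0 lt_neqAle dot_ge0 andbT eq_sym /dot psumr_eq0 => [|i _];
    last by rewrite -expr2 sqr_ge0.
  apply: contra ab => /allP d0; rewrite -subr_eq0; apply/eqP/rowP => i.
  by have := d0 i (mem_index_enum _); rewrite -expr2 sqrf_eq0 => /eqP ->;
    rewrite mxE.
have L2 : L ^+ 2 = dot d d by rewrite sqr_sqrtr// dot_ge0.
pose u := L^-1 *: d.
have uu : dot u u = 1.
  by rewrite /u dotZl dotC dotZl -L2 expr2 mulKf ?mulVf// gt_eqF.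
have dE : d = L *: u by rewrite scalerA mulfV ?scale1r// gt_eqF.
apply: (@le_trans _ _ (L * support_function P u)).
  apply: ge_sup_dot => y Py; rewrite -/d dE dotZl ler_wpM2l ?(ltW L0)//.
  exact: support_function_ub.
rewrite PE// vol_perp_shadow//.
have cS := compact_shadow uu cK.
(* The points a and b differ by a multiple of u: they lie over the same point, which serves as
   apex. *)
have bB : b *m (perp_frame u)^T = a *m (perp_frame u)^T.
  apply/eqP; rewrite eq_sym -subr_eq0 -mulmxBl -/d dE.
  by have := mulmx_tr_frame L 0 uu; rewrite mul0mx addr0 => ->.
have Lab : dot a u - dot b u = L.
  by rewrite -[RHS]mulr1 -uu -dotZl -dE /d !dot_mulmx mulmxBl !mxE.
have Ka' : K (dot a u *: u + a *m (perp_frame u)^T *m perp_frame u).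
  by rewrite frame_decomposition.
have Kb' : K (dot b u *: u + a *m (perp_frame u)^T *m perp_frame u).
  by rewrite -bB frame_decomposition.
have := @shadow_bound _ _ u K _ (dot a u) (dot b u) uu
  (compact_measurable_rV cK) (compact_measurable_rV cS) vK Ka' Kb'.
rewrite -subr_gt0 Lab => /(_ L0).
by rewrite !lebesgue_rV_vol// -!EFinM lee_fin.
Qed.

End projection.

(** * The inequality *)

Section polar.
Variable R : realType.

Lemma dilate_polarE n (c : R) (P : set 'rV[R]_n) : 0 < c -> compact P ->
  dilate c [set x | support_function P x <= 1] =
  [set x | forall y, P y -> dot x y <= c].
Proof.
move=> c0 cP; apply/seteqP; split => [_ [z /= z1 <-] y Py|x /= xc].
  rewrite dotZl -[leRHS]mulr1 ler_wpM2l ?(ltW c0)//.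
  exact: le_trans (support_function_ub _ cP Py) z1.
exists (c^-1 *: x); last by rewrite scalerA mulfV ?scale1r// gt_eqF.
(* The real [sup] of the empty set is 0, which is at most 1. *)
have [->|/set0P[p Pp]] := eqVneq P set0.
  by rewrite /support_function /= image_set0 sup0.
apply: ge_sup; first by exists (dot (c^-1 *: x) p), p.
by move=> _ [y Py <-]; rewrite dotZl ler_pdivrMl// mulr1 xc.
Qed.

Variable m : nat.
Implicit Types K : set 'rV[R]_m.+1.

Definition polar_multiple K : set 'rV[R]_m.+1 :=
  dilate (m.+1%:R * vol K) (polar_projection_body K).

Lemma projection_body_cases K :
  is_projection_body K (projection_body K) \/ projection_body K = set0.
Proof.
have [[P KP]|nP] := pselect (exists P, is_projection_body K P).
  by left; apply: xgetPex; exists P.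
by right; apply: xgetPN => P KP; apply: nP; exists P.
Qed.

Lemma polar_multipleE K : convex_body K ->
  polar_multiple K =
  [set x | forall y, projection_body K y -> dot x y <= m.+1%:R * vol K].
Proof.
move=> [cK _ iK]; rewrite /polar_multiple dilate_polarE ?mulr_gt0 ?vol_gt0//.
by case: (projection_body_cases K) => [[[]]//|->]; exact: compact0.
Qed.

(** An intersection of closed half-spaces; its measurability follows. *)
Lemma closed_polar_multiple K : convex_body K -> closed (polar_multiple K).
Proof.
move=> bK; rewrite (polar_multipleE bK).
rewrite (_ : mkset _ = \bigcap_(y in projection_body K)
  ((fun x => dot x y) @^-1` [set z | z <= m.+1%:R * vol K])); last first.
  by apply/seteqP; split => x /= h y; exact: h.
apply: closed_bigI => y _; apply: closed_comp => [x _|]; last exact: closed_le.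
exact: continuous_dotl.
Qed.

Lemma difference_polar_multiple K a b : convex_body K -> K a -> K b ->
  polar_multiple K (a - b).
Proof.
move=> bK Ka Kb; rewrite (polar_multipleE bK) => y Py.
case: (projection_body_cases K) => [KP|K0]; last by rewrite K0 in Py.
apply: le_trans (difference_support bK KP Ka Kb).
by apply: support_function_ub => //; case: KP => -[].
Qed.

(** For y in [K] the set y - K lies in [D], so the average is at most that of the constant mu(D). *)
Lemma translated_average_le K (mu : {measure set 'rV[R]_m.+1 -> \bar R}) D :
  convex_body K -> measurable D -> (forall a b, K a -> K b -> D (a - b)) ->
  (translated_average mu K <= mu D)%E.
Proof.
move=> [cK _ iK] mD KD; rewrite /translated_average.
have volK0 := vol_gt0 cK iK.
have mK := compact_measurable_rV cK.
have : (\int[@lebesgue_rV R m.+1]_(y in K) mu [set (y - z)%R | z in K] <=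
   \int[@lebesgue_rV R m.+1]_(y in K) cst (mu D) y)%E.
  rewrite integral_mkcond [leRHS]integral_mkcond.
  apply: ge0_le_integral_nomeas => y; rewrite !patchE; case: ifPn => //.
  rewrite inE => Ky; apply: le_measure; rewrite ?inE//.
    apply: compact_measurable_rV; apply: continuous_compact => //.
    apply: continuous_subspaceT => x.
    by apply: continuousB; [exact: cst_continuous|exact: cvg_id].
  by move=> _ [z Kz <-]; exact: KD.
rewrite integral_cst// -[X in (_ * X)%E]/(lebesgue_rV K) lebesgue_rV_vol//.
move=> /(lee_wpmul2l _) h.
apply: (le_trans (h _ _)); first by rewrite lee_fin invr_ge0 ltW.
by rewrite muleC -muleA -EFinM mulfV ?mule1// gt_eqF.
Qed.

Lemma translated_average_polar K (mu : {measure set 'rV[R]_m.+1 -> \bar R}) :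
  convex_body K -> (translated_average mu K <= mu (polar_multiple K))%E.
Proof.
move=> bK; apply: translated_average_le => //.
  by apply: closed_measurable_rV; exact: closed_polar_multiple.
by move=> a b Ka Kb; exact: difference_polar_multiple.
Qed.

End polar.

(** * Regularity of finite measures *)

Section regularity.
Variables (R : realType) (n : nat) (mu : {measure set 'rV[R]_n -> \bar R}).
Hypothesis mufin : (mu setT < +oo)%E.
Local Open Scope ereal_scope.
Implicit Types A F U : set 'rV[R]_n.

Let le_mu A U : measurable A -> measurable U -> A `<=` U -> mu A <= mu U.
Proof. by move=> mA mU AU; apply: le_measure; rewrite ?inE. Qed.

Let mu_lty A : measurable A -> mu A < +oo.
Proof. by move=> mA; apply: le_lt_trans mufin; exact: le_mu. Qed.

Let mu_fin A : measurable A -> mu A \is a fin_num.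
Proof. by move=> mA; rewrite ge0_fin_numE// mu_lty. Qed.

Let cvg_below_eps (f : (\bar R)^nat) (l : \bar R) (e : R) :
  f @ \oo --> l -> l \is a fin_num -> (0 < e)%R -> exists k, f k < l + e%:E.
Proof.
move=> fl lfin e0; apply/not_existsP => h.
have : l + e%:E <= lim (f @ \oo).
  apply: lime_ge; first by apply/cvg_ex; exists l.
  by apply: nearW => k; rewrite leNgt; exact/negP.
by rewrite (cvg_lim _ fl)// leNgt lteDl// lte_fin e0.
Qed.

(** Inner and outer approximation at once, measured by the gap between the two sets, so that
    complements merely exchange their roles. *)
Definition closed_open_approx A := measurable A /\ forall e : R, (0 < e)%R ->
  exists F U, [/\ closed F, open U, F `<=` A, A `<=` U & mu (U `\` F) < e%:E].

Let closed_box (r : R) : closed (box n r).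
Proof.
rewrite (_ : box n r = \bigcap_(i in setT)
  ((fun x : 'rV[R]_n => `|x ord0 i|%R) @^-1` [set z | (z <= r)%R])); last first.
  by apply/seteqP; split => x h i; [move=> _; exact: h|exact: (h i I)].
apply: closed_bigI => i _; apply: closed_comp => [x _|]; last exact: closed_le.
apply: continuous_comp; [exact: (@coord_continuous R 1 n ord0 i x)|exact:
  norm_continuous].
Qed.

(** Open neighbourhoods that decrease to [F] when [F] is closed; continuity from above then
    approximates [F] from outside. *)
Let thick F k : set 'rV[R]_n := \bigcup_(x in F) ball x (k.+1%:R^-1 : R)%R.

Let open_thick F k : open (thick F k).
Proof.
apply: bigcup_open => x _; apply: ball_open; by rewrite invr_gt0.
Qed.

Let closed_approx F : closed F -> closed_open_approx F.
Proof.
move=> cF; have mF := closed_measurable_rV cF; split=> // e e0.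
have mt k : measurable (thick F k) by apply: open_measurable_rV;
  exact: open_thick.
have Ft k : F `<=` thick F k.
  by move=> x Fx; exists x => //; apply: ballxx; rewrite invr_gt0.
have tF : \bigcap_k thick F k = F.
  apply/seteqP; split => [x hx|x Fx k _]; last exact: Ft.
  apply: cF => B /nbhs_ballP[d /= d0 dB].
  have [k kd] : exists k : nat, (k.+1%:R^-1 < d)%R.
    by have [k _ /(_ _ (leqnn k))] := near_infty_natSinv_lt (PosNum d0);
      exists k.
  have [y Fy yx] := hx k I; exists y; split => //; apply: dB.
  by apply: le_ball (ball_sym yx); exact: ltW.
have cvt : mu (thick F k) @[k --> \oo] --> mu F.
  rewrite -[X in _ --> mu X]tF; apply: nonincreasing_cvg_mu => //.
  - exact: mu_lty.
  - by rewrite tF.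
  move=> k l kl; apply/subsetPset => x [y Fy yx]; exists y => //.
  apply: le_ball yx; by rewrite lef_pV2 ?posrE// ler_nat.
have [k hk] := cvg_below_eps cvt (mu_fin mF) e0.
exists F, (thick F k); split => //.
rewrite measureD ?mu_lty// setIidr//.
by rewrite lteBlDl ?mu_fin.
Qed.

Let approxC A : closed_open_approx A -> closed_open_approx (~` A).
Proof.
move=> [mA hA]; split; first exact: measurableC.
move=> e /hA[F [U [cF oU FA AU UF]]]; exists (~` U), (~` F); split.
- exact: open_closedC.
- exact: closed_openC.
- exact: subsetC.
- exact: subsetC.
- by rewrite setDE setCK setIC -setDE.
Qed.

Let approx_bigcup (A : (set 'rV[R]_n)^nat) :
  (forall i, closed_open_approx (A i)) -> closed_open_approx (\bigcup_i A i).
Proof.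
move=> hA; split; first by apply: bigcupT_measurable => i; have [] := hA i.
move=> e e0.
have e20 : (0 < e / 2)%R by rewrite divr_gt0.
(* Half of e is spread over the sets as a geometric series; the other half pays for the truncation
   to [G k]. *)
have h i : exists FU : set 'rV[R]_n * set 'rV[R]_n,
    [/\ closed FU.1, open FU.2, FU.1 `<=` A i, A i `<=` FU.2 &
     mu (FU.2 `\` FU.1) < (e / 2 / (2 ^ i.+1)%:R)%:E].
  have [_ /(_ (e / 2 / (2 ^ i.+1)%:R)%R)] := hA i.
  rewrite divr_gt0// ?ltr0n ?expn_gt0// => /(_ isT)[F [U H]].
  by exists (F, U).
have [FU hFU] := choice h.
pose U := \bigcup_i (FU i).2.
(* The union of all the closed sets may fail to be closed, hence the finite unions. *)
pose G k := \bigcup_(i < k) (FU i).1.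
have cF i : closed (FU i).1 by have [] := hFU i.
have oU i : open (FU i).2 by have [] := hFU i.
have cG k : closed (G k).
  rewrite /G bigcup_mkord; apply: big_ind => //;
    [exact: closed0|exact: closedU].
have oUU : open U by exact: bigcup_open.
have mU : measurable U by exact: open_measurable_rV.
have mG k : measurable (G k) by exact: closed_measurable_rV.
have mGG : measurable (\bigcup_i (FU i).1).
  by apply: bigcupT_measurable => i; exact: closed_measurable_rV.
have capE : \bigcap_k (U `\` G k) = U `\` \bigcup_i (FU i).1.
  apply/seteqP; split => [x hx|x [Ux nx] k _].
    split; first by have [] := hx 0%N I.
    move=> [i _ Fx]; have [_] := hx i.+1 I; apply.
    by exists i => /=.
  by split=> //; move=> -[i _ ?]; apply: nx; exists i.
have cvU : mu (U `\` G k) @[k --> \oo] --> mu (U `\` \bigcup_i (FU i).1).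
  rewrite -capE; apply: nonincreasing_cvg_mu.
  - by apply: mu_lty; exact: measurableD.
  - by move=> k; exact: measurableD.
  - by rewrite capE; exact: measurableD.
  move=> k l kl; apply/subsetPset; apply: setDS.
  by move=> x [i /= ik Fx]; exists i => //=; exact: leq_trans ik kl.
have le2 : mu (U `\` \bigcup_i (FU i).1) <= (e / 2)%:E.
  apply: le_trans (epsilon_trick0 xpredT (ltW e20)).
  apply: (@le_trans _ _ (\sum_(0 <= i <oo) mu ((FU i).2 `\` (FU i).1))).
    apply: measure_sigma_subadditive.
    - by move=> i; apply: measurableD; [exact: open_measurable_rV|exact:
      closed_measurable_rV].
    - exact: measurableD.
    - by move=> x [[i _ Ui] nx]; exists i => //; split=> // Fi; apply: nx;
      exists i.
  apply: lee_nneseries => // i _; apply/ltW.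
  by have [] := hFU i.
have mD : measurable (U `\` \bigcup_i (FU i).1) by exact: measurableD.
have [k hk] := cvg_below_eps cvU (mu_fin mD) e20.
exists (G k), U; split => //.
- move=> x [i _ Fx]; exists i => //.
  by have [_ _ + _ _] := hFU i; exact.
- move=> x [i _ Ax]; exists i => //.
  by have [_ _ _ + _] := hFU i; exact.
- apply: lt_le_trans hk _; rewrite [e in leRHS]splitr EFinD.
  by rewrite leeD2r.
Qed.

(** The sets with this property form a sigma-algebra, which contains the open sets as complements of
    closed ones. *)
Lemma borel_approx A : measurable A -> closed_open_approx A.
Proof.
apply: smallest_sub => [|U oU]; last first.
  by rewrite -(setCK U); apply: approxC; apply: closed_approx;
    exact: open_closedC.
split.
- by apply: closed_approx; exact: closed0.
- by move=> B; rewrite setTD; exact: approxC.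
- exact: approx_bigcup.
Qed.

Lemma finite_measure_regular : regular_measure mu.
Proof.
move=> A mA; have [_ hA] := borel_approx mA; split; apply/eqP; rewrite eq_le;
  apply/andP; split.
- apply: le_ereal_inf_tmp => _ [U [oU AU] <-].
  by apply: le_mu => //; exact: open_measurable_rV.
- apply/lee_addgt0Pr => e /hA[F [U [cF oU FA AU UF]]].
  apply: (@le_trans _ _ (mu U)); first by apply: ereal_inf_lbound; exists U.
  have mF := closed_measurable_rV cF; have mU := open_measurable_rV oU.
  rewrite (measureDI mu mU mF) addeC leeD//; last exact: ltW.
  apply: le_mu => //; first exact: measurableI.
  by move=> x [_ /FA].
- apply/lee_addgt0Pr => e e0; have e20 : (0 < e / 2)%R by rewrite divr_gt0.
  have [F [U [cF oU FA AU UF]]] := hA _ e20.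
  have mF := closed_measurable_rV cF; have mU := open_measurable_rV oU.
  (* Closed inner sets are made compact by cutting them with growing cubes, at a loss that tends to
     0. *)
  have Fbox : \bigcup_k (F `&` box n k%:R) = F.
    rewrite -setI_bigcupr; apply: setIidl => x _.
    have [r r0 /(_ x erefl) xr] := compact_sub_box (@compact_set1 _ x).
    exists (Num.bound r) => // i; apply: le_trans (xr i) _.
    by apply/ltW/archi_boundP/ltW.
  have mFk k : measurable (F `&` box n k%:R) by apply: measurableI => //;
    exact: measurable_box.
  have cvF : mu (F `&` box n k%:R) @[k --> \oo] --> mu F.
    rewrite -[X in _ --> mu X]Fbox; apply: nondecreasing_cvg_mu => //;
      first by rewrite Fbox.
    move=> k l kl; apply/subsetPset; apply: setIS => x xk i.
    by apply: le_trans (xk i) _; rewrite ler_nat.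
  have FS : mu F <= ereal_sup [set mu C | C in [set C | compact C /\ C `<=` A]].
    rewrite -(cvg_lim _ cvF)//; apply: lime_le; first by apply/cvg_ex;
      exists (mu F).
    apply: nearW => k; apply: ereal_sup_ubound;
      exists (F `&` box n k%:R) => //; split.
      apply: bounded_closed_compact; last by apply: closedI => //;
        exact: closed_box.
      exists k%:R; split => [|r kr x [_ xk]]; first exact: num_real.
      rewrite /= [leLHS]mx_normrE; apply: bigmax_le => [|[i j] _ /=];
        first exact: le_trans (ltW kr).
      by rewrite (ord1 i) (le_trans (xk j))// ltW.
    by move=> x [/FA].
  apply: (@le_trans _ _ (mu F + (e / 2)%:E)); last first.
    by rewrite leeD// lee_fin ler_pdivrMr// ler_pMr// ler1n.
  apply: (@le_trans _ _ (mu U)); first exact: le_mu.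
  rewrite (measureDI mu mU mF) addeC leeD//; last exact: ltW.
  by apply: le_mu => //; exact: measurableI.
- apply: ge_ereal_sup => _ [C [cC CA] <-].
  by apply: le_mu => //; exact: compact_measurable_rV.
Qed.

End regularity.

(** * The Gaussian measure *)

Section gaussian_measure.
Variable R : realType.
Local Open Scope ereal_scope.
Local Notation mu1 := (@lebesgue_measure R).
Local Notation leb n := (@lebesgue_rV R n).

(** Counterpart of [lebesgue_rVS] for functions, along which the Gaussian integral factorizes. *)
Lemma integral_lebesgue_rVS n (f : 'rV[R]_n.+1 -> \bar R) :
  measurable_fun setT f -> (forall x, 0 <= f x) ->
  \int[leb n.+1]_x f x = \int[mu1]_s \int[leb n]_w f (cons_rV s w).
Proof.
move=> mf f0.
rewrite -[LHS]/(\int[pushforward (sf_measure (iprod R n.+1))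
  (@iprod_row R n.+1)]_x f x).
rewrite ge0_integral_pushforward//; last exact: measurable_iprod_row.
transitivity (\int[mu1 \x sf_measure (iprod R n)]_z (f \o @iprod_row R n.+1) z).
  by [].
have mfr : measurable_fun setT (f \o @iprod_row R n.+1).
  by apply: measurableT_comp; [exact: mf|exact: measurable_iprod_row].
rewrite (fubini_tonelli1 _ mfr); last by move=> z; exact: f0.
apply: eq_integral => s _.
rewrite -[RHS]/(\int[pushforward (sf_measure (iprod R n)) (@iprod_row R n)]_w
  f (cons_rV s w)).
rewrite ge0_integral_pushforward//.
- by rewrite /fubini_F; apply: eq_integral => t _ /=; rewrite iprod_row_cons.
- exact: measurable_iprod_row.
- exact: (measurableT_comp mf (measurable_fun_pair2 s (@measurable_cons_rV R
  n))).
Qed.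

Lemma gauss_density_cons n (s : R) (w : 'rV[R]_n) :
  gauss_density (cons_rV s w) = (normal_pdf 0 1 s * gauss_density w)%R.
Proof.
rewrite normal_pdfE// /normal_peak /normal_fun /gauss_density dot_cons_rV.
have -> : (- (n.+1%:R / 2) = - 2^-1 + - (n%:R / 2) :> R)%R.
  by rewrite -natr1; lra.
have pi20 : (0 < 2 * pi :> R)%R by rewrite mulr_gt0// pi_gt0.
rewrite powRD; last by rewrite (gt_eqF pi20) implybT.
rewrite [((2 * pi) `^ (- 2^-1))%R]powRN powR12_sqrt ?(ltW pi20)//.
have -> : (- ((s * s + dot w w) / 2) = - (s - 0) ^+ 2 / (1 ^+ 2 *+ 2)
  + - (dot w w / 2) :> R)%R.
  by rewrite subr0 expr1n; field.
rewrite expRD expr1n mul1r mulr_natl; ring.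
Qed.

(** By induction, each coordinate contributing the integral of the one-dimensional normal
    density. *)
Lemma gaussian_setT n : @gaussian R n setT = 1.
Proof.
rewrite /gaussian; elim: n => [|n IHn].
  (* R^0 is a point of mass 1, where the density is (2 pi)^0 exp(0) = 1. *)
  transitivity (\int[leb 0]_(x in setT) cst 1 x).
    apply: eq_integral => x _; rewrite /gauss_density mul0r oppr0 powRr0 mul1r.
    by rewrite /dot big_ord0 mul0r oppr0 expR0.
  rewrite integral_cst// mul1e -[LHS]/(leb 0 setT).
  by rewrite /lebesgue_rV /pushforward /= diracT.
rewrite integral_lebesgue_rVS; last 2 first.
- by apply/measurable_EFinP; exact: measurable_gauss_density.
- by move=> x; rewrite lee_fin gauss_density_ge0.
rewrite -(@integral_normal_pdf R 0 1) //.
apply: eq_integral => s _.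
under eq_integral do rewrite gauss_density_cons EFinM.
rewrite ge0_integralZl ?IHn ?mule1//.
- by apply/measurable_EFinP; exact: measurable_gauss_density.
- by move=> x _; rewrite lee_fin gauss_density_ge0.
- by rewrite lee_fin normal_pdf_ge0.
Qed.

Lemma Lambda_gaussian n : Lambda (@gaussian R n).
Proof.
have fin : @gaussian R n setT < +oo by rewrite gaussian_setT ltry.
split.
- by move=> x; exists setT => //; split => //; exact: openT.
- exact: finite_measure_regular.
- exists (@gauss_density R n); split => //; first exact: gauss_density_ge0.
  split=> [|C cC]; first exact: measurable_gauss_density.
  apply: (@integrableS _ _ _ _ setT) => //; first exact: compact_measurable_rV.
  apply/integrableP; split.
    by apply/measurable_EFinP; exact: measurable_gauss_density.
  under eq_integral do rewrite /= ger0_norm ?gauss_density_ge0//.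
  exact: fin.
Qed.

End gaussian_measure.

(** * Translated averages of dilates *)

Section dilation.
Variables (R : realType) (n : nat).
Implicit Types K : set 'rV[R]_n.

Lemma dilateE (t : R) K : 0 < t -> dilate t K = [set y | K (t^-1 *: y)].
Proof.
move=> t0; have tn0 : t != 0 by rewrite gt_eqF.
apply/seteqP; split => [_ [x Kx <-]|y Ky] /=;
  first by rewrite scalerA mulVf// scale1r.
by exists (t^-1 *: y) => //; rewrite scalerA mulfV// scale1r.
Qed.

Lemma convex_body_dilate (t : R) K :
  0 < t -> convex_body K -> convex_body (dilate t K).
Proof.
move=> t0 [cK vK [x]]; rewrite /interior => /nbhs_ballP[e /= e0 eK]; split.
- apply: continuous_compact => //; apply: continuous_subspaceT => y.
  exact: scaler_continuous.
- move=> a b l; rewrite !inE => -[a' Ka' <-] [b' Kb' <-].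
  have := vK a' b' l; rewrite !inE => /(_ Ka' Kb') h.
  exists (l%:num *: a' + (1 - l%:num) *: b') => //.
  by rewrite scalerDr !scalerA ![t * _]mulrC -!scalerA.
exists (t *: x); rewrite /interior; apply/nbhs_ballP; exists (t * e) => /=;
  first by rewrite mulr_gt0.
rewrite dilateE// => y; rewrite -ball_normE /ball_ /= => xy; apply: eK.
rewrite -ball_normE /ball_ /=.
have -> : x - t^-1 *: y = t^-1 *: (t *: x - y).
  by rewrite scalerBr scalerA mulVf ?scale1r// gt_eqF.
by rewrite normrZ gtr0_norm ?invr_gt0// ltr_pdivrMl.
Qed.

Lemma lebesgue_rV_dilate (t : R) K : 0 < t -> measurable K ->
  lebesgue_rV (dilate t K) = ((t ^+ n)%:E * lebesgue_rV K)%E.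
Proof.
by move=> t0 mK; rewrite dilateE// lebesgue_rV_scale ?invr_gt0// exprVn invrK.
Qed.

Lemma vol_dilate (t : R) K :
  0 < t -> compact K -> vol (dilate t K) = t ^+ n * vol K.
Proof.
move=> t0 cK; rewrite /vol lebesgue_rV_dilate//;
  last exact: compact_measurable_rV.
by rewrite lebesgue_rV_vol.
Qed.

(** The integral is restricted to E = t B, where B is [K] shrunk towards [x0] by the ratio 1 - e.
    For y in E the set y - t K contains the cube, and E fills the fraction (1 - e)^n of t K. *)
Lemma translated_average_ge (mu : {measure set 'rV[R]_n -> \bar R})
    K x0 rho (t e : R) :
  convex_body K -> 0 < t -> 0 < e < 1 -> 0 <= rho ->
  (forall y, box n rho (y - x0) -> K y) ->
  (((1 - e) ^+ n)%:E * mu (box n (t * e * rho)) <=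
   translated_average mu (dilate t K))%E.
Proof.
move=> bK t0 /andP[e0 e1] rho0 xK; have [cK vK iK] := bK.
have [ctK _ itK] := convex_body_dilate t0 bK.
have mtK := compact_measurable_rV ctK; have mK := compact_measurable_rV cK.
have volK0 := vol_gt0 cK iK.
have e10 : 0 < 1 - e by rewrite subr_gt0.
pose B := [set z : 'rV[R]_n | K (x0 + (1 - e)^-1 *: (z - x0))].
have mB : measurable B.
  apply: (measurable_preimage (f := fun z : 'rV[R]_n => x0 + (1 - e)^-1 *:
    (z - x0))) => //.
  apply: measurable_add_rV => //; apply: measurable_scale_rV => //.
  exact: measurable_add_rV.
pose E := dilate t B.
have mE : measurable E.
  rewrite /E dilateE//.
  apply: (measurable_preimage (f := fun z : 'rV[R]_n => t^-1 *: z)) => //.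
  exact: measurable_scale_rV.
have volE : lebesgue_rV E = (t ^+ n * (1 - e) ^+ n * vol K)%:E.
  rewrite lebesgue_rV_dilate// lebesgue_homothety ?invr_gt0//.
  by rewrite exprVn invrK lebesgue_rV_vol// -!EFinM mulrA.
(* The point is (1 - e) k + e (x0 - v/e), where v/e lies in the cube of half-side rho. *)
have BK k : K k -> forall v, box n (e * rho) v ->
    K ((1 - e) *: k + e *: x0 - v).
  move=> Kk v bv.
  have Kxv : K (x0 - e^-1 *: v).
    apply: xK => i; rewrite addrC addKr !mxE normrN normrM gtr0_norm
      ?invr_gt0//.
    by rewrite ler_pdivrMl.
  have e01 : 0 <= e <= 1 by rewrite !ltW.
  have := convex_setP vK e01 Kxv Kk; congr (K _).
  by rewrite scalerBr scalerA mulfV ?gt_eqF// scale1r addrC addrA.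
have EK y v : E y -> box n (t * e * rho) v -> dilate t K (y - v).
  rewrite /E !dilateE//= => Ey bv.
  have bv' : box n (e * rho) (t^-1 *: v).
    move=> i; rewrite !mxE normrM gtr0_norm ?invr_gt0// ler_pdivrMl// mulrA.
    exact: bv.
  have := BK _ Ey _ bv'; congr (K _).
  rewrite scalerDr scalerA mulfV ?gt_eqF// scale1r scalerBr; congr (_ - _).
  by move: (t^-1 *: y) => z; apply/rowP => i; rewrite !mxE; ring.
have ErK : E `<=` dilate t K.
  move=> y Ey; rewrite -[y]subr0; apply: EK => // i.
  by rewrite mxE normr0 !mulr_ge0// ltW.
have ItE : (\int[@lebesgue_rV R n]_(y in E) cst (mu (box n (t * e * rho))) y <=
    \int[@lebesgue_rV R n]_(y in dilate t K)
      mu [set (y - z)%R | z in dilate t K])%E.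
  rewrite integral_mkcond [leRHS]integral_mkcond.
  apply: ge0_le_integral_nomeas => y; rewrite !patchE; first by case: ifPn.
  case: ifPn => [|_]; last by case: ifPn => _; [exact: measure_ge0|exact: lexx].
  rewrite inE => Ey; rewrite mem_set; last exact: ErK.
  apply: le_measure; rewrite ?inE; first exact: measurable_box.
    apply: compact_measurable_rV; apply: continuous_compact => //.
    apply: continuous_subspaceT => x.
    by apply: continuousB; [exact: cst_continuous|exact: cvg_id].
  (* Each v of the cube is y - (y - v), with y - v in the dilate. *)
  by move=> v bv; exists (y - v); [exact: EK|rewrite opprB addrC subrK].
move: ItE; rewrite integral_cst// (_ : (_ * _)%E =
  (mu (box n (t * e * rho)) * (t ^+ n * (1 - e) ^+ n * vol K)%:E)%E);
    last by rewrite -volE.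
move=> ItE.
have tvol0 : 0 < vol (dilate t K) by rewrite vol_gt0.
have tv0 : (0 <= ((vol (dilate t K))^-1)%:E :> \bar R)%E by rewrite lee_fin
  invr_ge0 ltW.
apply: le_trans (lee_wpmul2l tv0 ItE).
rewrite muleCA -EFinM muleC vol_dilate//.
rewrite (_ : (t ^+ n * vol K)^-1 * _ = (1 - e) ^+ n)//.
by field; rewrite !gt_eqF// exprn_gt0.
Qed.

End dilation.

(** * The limit for large dilates *)

Section gaussian_limit.
Variables (R : realType) (m : nat).
Implicit Types K : set 'rV[R]_m.+1.

Lemma bernoulli_le (e : R) k : 0 <= e <= 1 -> 1 - k%:R * e <= (1 - e) ^+ k.
Proof.
move=> /andP[e0 e1]; elim: k => [|k IH]; first by rewrite mul0r subr0 expr0.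
rewrite exprSr -natr1; apply: (@le_trans _ _ ((1 - k%:R * e) * (1 - e))).
  have : 0 <= k%:R * e * e by rewrite !mulr_ge0.
  by lra.
by rewrite ler_wpM2r// subr_ge0.
Qed.

(** Continuity from below along the cubes of integer half-side, which exhaust the space;
    monotonicity gives all larger r. *)
Lemma gaussian_box_cvg (e : R) : 0 < e ->
  exists2 r0 : R, 0 < r0 &
    forall r, r0 <= r -> ((1 - e)%:E <= @gaussian R m.+1 (box m.+1 r))%E.
Proof.
move=> e0.
have bT : \bigcup_k box m.+1 (k%:R : R) = setT.
  rewrite -subTset => x _; have [r r0 /(_ x erefl) xr] := compact_sub_box
    (@compact_set1 _ x).
  exists (Num.bound r) => // i; apply: le_trans (xr i) _.
  by apply/ltW/archi_boundP/ltW.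
have cv : gaussian (box m.+1 k%:R) @[k --> \oo] --> (1 : \bar R)%E.
  rewrite -(gaussian_setT R m.+1) -bT; apply: nondecreasing_cvg_mu.
  - by move=> k; exact: measurable_box.
  - by rewrite bT.
  move=> k l kl; apply/subsetPset => x xk i.
  by apply: le_trans (xk i) _; rewrite ler_nat.
have [k kP] : exists k : nat,
    ((1 - e)%:E <= @gaussian R m.+1 (box m.+1 k%:R))%E.
  apply/not_existsP => h.
  have : (lim (gaussian (box m.+1 (k%:R : R)) @[k --> \oo]) <= (1 - e)%:E)%E.
    apply: lime_le; first by apply/cvg_ex; exists 1%E.
    by apply: nearW => k; apply/ltW; rewrite ltNge; exact/negP.
  by rewrite (cvg_lim _ cv)// lee_fin lerBrDl gerDr leNgt e0.
exists k.+1%:R => // r kr; apply: (le_trans kP).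
apply: le_measure; rewrite ?inE; [exact: measurable_box|exact: measurable_box|].
by move=> x xk i; rewrite (le_trans (xk i))// (le_trans _ kr)// ler_nat.
Qed.

Lemma gaussian_le1 (A : set 'rV[R]_m.+1) : measurable A -> (gaussian A <= 1)%E.
Proof.
by move=> mA; rewrite -(gaussian_setT R m.+1); apply: le_measure; rewrite ?inE.
Qed.

Lemma translated_average_gaussian_cvg K :
  convex_body K -> forall e : R, 0 < e ->
  \forall t \near +oo, 0 < t /\
   ((1 - e)%:E <= translated_average (@gaussian R m.+1) (dilate t K))%E.
Proof.
move=> bK eta eta0; have [_ _ [x0]] := bK;
  rewrite /interior => /nbhs_ballP[d /= d0 dK].
(* The volume costs (1 - e)^(m+1) and the cube one more factor 1 - e; by Bernoulli the product is at
   least 1 - (m+2) e >= 1 - eta. The bound 1/2 keeps e below 1. *)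
pose e := Num.min (eta / m.+2%:R) 2^-1.
have e_gt0 : 0 < e by rewrite lt_min invr_gt0 ltr0n andbT divr_gt0.
have e_lt1 : e < 1 by rewrite gt_min invf_lt1// ltr1n orbT.
have [r r0 hr] := gaussian_box_cvg e_gt0.
have rho0 : 0 < d / 2 by rewrite divr_gt0.
have xK y : box m.+1 (d / 2) (y - x0) -> K y.
  by move=> ?; apply: dK; exact: closed_box_ball.
near=> t.
have t0 : 0 < t by near: t; exact: nbhs_pinfty_gt.
(* From here on the half-side t e d/2 of the cube is at least r. *)
have rt : r / (e * (d / 2)) <= t.
  by near: t; apply: nbhs_pinfty_ge; exact: num_real.
split=> //.
have e01 : 0 < e < 1 by rewrite e_gt0.
apply: le_trans (translated_average_ge (@gaussian R m.+1) bK t0 e01 (ltW rho0)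
  xK).
apply: (@le_trans _ _ (((1 - e) ^+ m.+1)%:E * (1 - e)%:E)%E); last first.
  rewrite lee_wpmul2l ?lee_fin ?exprn_ge0 ?subr_ge0 ?(ltW e_lt1)// hr//.
  by rewrite -mulrA -ler_pdivrMr ?mulr_gt0.
rewrite -EFinM lee_fin -exprSr.
apply: le_trans (bernoulli_le m.+2 _); last by rewrite !ltW.
rewrite lerD2l lerN2 -ler_pdivlMl// mulrC.
by rewrite /e ge_min lexx.
Unshelve. all: by end_near.
Qed.

(** A squeeze: if N and D are the numerator and the denominator, then 1 - e <= N <= D <= 1 for large
    t, so N / D lies between 1 - e and 1. *)
Lemma gaussian_ratio_cvg K : convex_body K ->
  fine (translated_average (@gaussian R m.+1) (dilate t K)) /
  fine (@gaussian R m.+1 (polar_multiple (dilate t K)))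
    @[t --> +oo%R] --> (1 : R).
Proof.
move=> bK; apply/cvgrPdist_le => e e0.
(* The bound 1/2 keeps the numerator, hence the denominator, positive even when e is large. *)
have e1 : 0 < Num.min e 2^-1 by rewrite lt_min e0 invr_gt0 ltr0n.
apply: filterS (translated_average_gaussian_cvg bK e1) => t [t0 eT].
have btK := convex_body_dilate t0 bK.
have mP : measurable (polar_multiple (dilate t K)).
  by apply: closed_measurable_rV; exact: closed_polar_multiple.
pose T := translated_average (@gaussian R m.+1) (dilate t K).
pose G := @gaussian R m.+1 (polar_multiple (dilate t K)).
have TG : (T <= G)%E by exact: translated_average_polar.
have G1 : (G <= 1)%E by exact: gaussian_le1.
have G0 : (0 <= G)%E by exact: measure_ge0.
have T0 : (0 <= T)%E.
  rewrite mule_ge0 ?lee_fin ?invr_ge0 ?fine_ge0//.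
  by apply: integral_ge0 => y _; exact: measure_ge0.
have Gfin : G \is a fin_num by rewrite ge0_fin_numE// (le_lt_trans G1)// ltry.
have Tfin : T \is a fin_num.
  by rewrite ge0_fin_numE// (le_lt_trans (le_trans TG G1))// ltry.
move: TG G1 eT; rewrite -/T -/G.
rewrite -(fineK Gfin) -(fineK Tfin) !lee_fin /=.
move: (fine T) (fine G) => N D ND D1 eN.
have N0' : 0 < N.
  by apply: lt_le_trans eN; rewrite subr_gt0 gt_min invf_lt1// ltr1n orbT.
have D0' : 0 < D by apply: lt_le_trans ND.
rewrite ger0_norm ?subr_ge0 ?ler_pdivrMr ?mul1r//.
rewrite lerBlDl -lerBlDr; apply: (@le_trans _ _ N).
  by apply: le_trans eN; rewrite lerD2l lerN2 ge_min lexx.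
by rewrite ler_pdivlMr// ler_piMr// ltW.
Qed.

End gaussian_limit.

Theorem theorem3p1 (R : realType) (n : nat) (n_gt0 : (0 < n)%N) :
  (forall (K : set 'rV[R]_n) (mu : {measure set 'rV[R]_n -> \bar R}),
     convex_body K -> Lambda mu ->
     (translated_average mu K <=
      mu (dilate (n%:R * vol K) (polar_projection_body K)))%E) /\
  (Lambda (@gaussian R n) /\
   forall K : set 'rV[R]_n, convex_body K ->
     (fun t : R =>
        fine (translated_average (@gaussian R n) (dilate t K)) /
        fine (@gaussian R n (dilate (n%:R * vol (dilate t K))
                               (polar_projection_body (dilate t K)))))
       @ +oo%R --> (1 : R)).
Proof.
case: n n_gt0 => // m _; split; [|split].
- by move=> K mu bK _; exact: translated_average_polar.
- exact: Lambda_gaussian.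
- by move=> K bK; exact: gaussian_ratio_cvg.
Qed.
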